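(* Let $I$ be an index set, let $\mathcal A$ be a unital $C^*$-algebra and $\mathcal I$ a closed ideal in $\mathcal A$, with quotient map $\pi:\mathcal A\to\mathcal A/\mathcal I$. Then every unital completely positive map $\varphi:\mathfrak C_I\to\mathcal A/\mathcal I$ lifts to a unital completely positive map $\tilde\varphi:\mathfrak C_I\to\mathcal A$, i.e. $\pi\circ\tilde\varphi=\varphi$.
   Context: Operator systems are abstract (Choi–Effros) operator systems, not assumed complete. Ideals are two-sided. Coproduct: for a family $\{\mathcal S_\lambda\}_{\lambda\in\Lambda}$ of operator systems, $\oplus_1\{\mathcal S_\lambda:\lambda\in\Lambda\}$ is the algebraic direct sum (finitely supported families) modulo the subspace spanned by the differences $n_{\lambda_1}-n_{\lambda_2}$, where $n_\lambda$ is $1_{\mathcal S_\lambda}$ in coordinate $\lambda$ and $0$ elsewhere (so all units are identified). Elements of $M_n$ of it are written $\sum_{\lambda\in F}x_\lambda$ with $F\subset\Lambda$ finite and $x_\lambda\in M_n(\mathcal S_\lambda)$; the involution is $(\sum x_\lambda)^*=\sum x_\lambda^*$, and $\sum_{\lambda\in F}x_\lambda\ge0$ iff $\sum_{\lambda\in F}\omega_\lambda(x_\lambda)\ge0$ for every family of states $\omega_\lambda$ on $M_n(\mathcal S_\lambda)$, $\lambda\in F$, whose restrictions to $M_n\cong M_n\otimes\mathbb C1_{\mathcal S_\lambda}$ all coincide. The order unit is the common class of the $n_\lambda$. The operator system $\mathfrak C_I$: let $I$ be a (nonempty) index set and $\{I_k\}_{k\in\mathbb N}$ a sequence of index sets,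 each of the same cardinality as $I$. For $\iota_k\in I_k$ let $\mathfrak C_{\iota_k}$ be the operator subsystem of (a copy, labelled $\iota_k$, of) $M_k(C([0,1]))$ spanned by $e_{ij}\otimes1$ and $e_{ij}\otimes t$, $1\le i,j\le k$, where $1,t\in C([0,1])$ are the constant function and the coordinate function. Then $\mathfrak C_I:=\oplus_1\{\mathfrak C_{\iota_k}:k\in\mathbb N,\iota_k\in I_k\}$. *)

(* Defs.v *)
From HB Require Import structures.
From mathcomp Require Import all_boot all_order all_algebra finmap complex.
From mathcomp Require Import boolp classical_sets functions cardinality.
From mathcomp Require Import set_interval reals topology normedtype.
From mathcomp Require Import ring.
Set Implicit Arguments.
Unset Strict Implicit.
Unset Printing Implicit Defensive.
Import Order.TTheory GRing.Theory Num.Theory.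
Import numFieldNormedType.Exports.
Local Open Scope classical_set_scope.
Local Open Scope ring_scope.

(* Typed as a numClosedFieldType so that C carries its order (z <= w iff w - z
   is a nonnegative real), its conjugation and its norm topology. *)
Definition cplx (R : realType) : numClosedFieldType := R[i].

HB.mixin Record Lmodule_hasStar (R : realType) V of GRing.Lmodule (cplx R) V := {
  star : V -> V;
  starK : involutive star;
  starD : {morph star : x y / x + y};
  starZ : forall (a : cplx R) (x : V), star (a *: x) = a^* *: star x
}.

#[short(type="starLmodType")]
HB.structure Definition StarLmodule (R : realType) :=
  {V of GRing.Lmodule (cplx R) V & Lmodule_hasStar R V}.

Section StarLmoduleTheory.
Variables (R : realType) (V : starLmodType R).

Lemma star0 : star (0 : V) = 0.
Proof. by have := starZ 0 (0 : V); rewrite conjC0 !scale0r. Qed.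

Lemma starN (x : V) : star (- x) = - star x.
Proof. by rewrite -[- x]scaleN1r starZ conjCN1 scaleN1r. Qed.

End StarLmoduleTheory.

HB.mixin Record isStarSubmod (R : realType) (V : starLmodType R) (S : {pred V}) := {
  star_rpredZ : forall (a : cplx R) (x : V), x \in S -> a *: x \in S;
  star_rpred : forall x : V, x \in S -> star x \in S
}.

#[short(type="starSubmod")]
HB.structure Definition StarSubmod (R : realType) (V : starLmodType R) :=
  {S of GRing.ZmodClosed V S & isStarSubmod R V S}.

(* The product is a field of the mixin, rather than inherited from PzRing, since
   the MathComp hierarchy has no join of Lmodule and PzRing that admits the zero
   algebra, and A/J is zero when J = A.  The ring structure is recovered below. *)
HB.mixin Record isStarAlgebra (R : realType) A of StarLmodule R A := {
  sone : A;
  smul : A -> A -> A;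
  smulA : associative smul;
  smul1l : left_id sone smul;
  smul1r : right_id sone smul;
  smulDl : left_distributive smul +%R;
  smulDr : right_distributive smul +%R;
  smulZl : forall (a : cplx R) (x y : A), smul (a *: x) y = a *: smul x y;
  smulZr : forall (a : cplx R) (x y : A), smul x (a *: y) = a *: smul x y;
  star_smul : forall x y : A, star (smul x y) = smul (star y) (star x)
}.

#[short(type="starAlgType")]
HB.structure Definition StarAlgebra (R : realType) :=
  {A of StarLmodule R A & isStarAlgebra R A}.

HB.instance Definition _ (R : realType) (A : starAlgType R) :=
  GRing.Zmodule_isPzRing.Build (StarAlgebra.sort A)
    (@smulA R A) (@smul1l R A) (@smul1r R A) (@smulDl R A) (@smulDr R A).

Section StarAlgebraTheory.
Variables (R : realType) (A : starAlgType R).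
Implicit Types (a : cplx R) (x y : A).

Lemma starM x y : star (x * y) = star y * star x. Proof. exact: star_smul. Qed.

Lemma star1 : star (1 : A) = 1.
Proof. by rewrite -[LHS]mulr1 -[X in _ * X](starK (1 : A)) -starM mulr1 starK. Qed.

Lemma starAl a x y : (a *: x) * y = a *: (x * y). Proof. exact: smulZl. Qed.

Lemma starAr a x y : x * (a *: y) = a *: (x * y). Proof. exact: smulZr. Qed.

End StarAlgebraTheory.

(* The norm is C-valued, as in normedModType C; its values are nonnegative reals. *)
HB.mixin Record isCStar (R : realType) A
    of StarAlgebra R A & NormedModule (cplx R) A := {
  cstar_normM : forall x y : A, `|smul x y| <= `|x| * `|y|;
  cstar_norm : forall x : A, `|smul (star x) x| = `|x| ^+ 2
}.

#[short(type="cstarAlgType")]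
HB.structure Definition CStarAlgebra (R : realType) :=
  {A of StarAlgebra R A & CompleteNormedModule (cplx R) A & isCStar R A}.

HB.instance Definition _ (R : realType) (A : cstarAlgType R) :=
  GRing.PzRing.copy (CStarAlgebra.sort A) (StarAlgebra.sort A).

(* Two-sided, and not assumed self-adjoint: that is the lemma ideal_star. *)
HB.mixin Record isClosedIdeal (R : realType) (A : cstarAlgType R) (J : {pred A}) := {
  idealMl : forall a x : A, x \in J -> a * x \in J;
  idealMr : forall a x : A, x \in J -> x * a \in J;
  ideal_closed : closed [set x | x \in J]
}.

#[short(type="closedIdeal")]
HB.structure Definition ClosedIdeal (R : realType) (A : cstarAlgType R) :=
  {J of GRing.ZmodClosed A J & isClosedIdeal R A J}.


Section CStarTheory.
Variables (R : realType) (A : cstarAlgType R).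
Implicit Types (x y : A) (a : cplx R).

Let normM x y : `|x * y| <= `|x| * `|y|. Proof. exact: cstar_normM. Qed.
Let normCS x : `|star x * x| = `|x| ^+ 2. Proof. exact: cstar_norm. Qed.

Let norm1_le1 : `|1 : A| <= 1.
Proof.
have := normCS 1; rewrite star1 mulr1.
have [->|n0] := eqVneq (`|1 : A|) 0; first by rewrite ler01.
by rewrite expr2 -[X in X = _]mulr1 => /(mulfI n0) <-.
Qed.

Let norm_star x : `|star x| = `|x|.
Proof.
suff le y : `|y| <= `|star y|.
  by apply/le_anti; rewrite le andbT -{2}[x]starK le.
have [->|y0] := eqVneq `|y| 0; first exact: normr_ge0.
have y1 : 0 < `|y| by rewrite lt_def y0 normr_ge0.
by rewrite -(ler_pM2r y1) -expr2 -normCS normM.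
Qed.

Let half_small (e : cplx R) : 0 < e -> exists n, forall m, (n <= m)%N -> 2^-1 ^+ m < e.
Proof.
case: e => er ei; rewrite ltcE /= => /andP[/eqP -> er0].
exists (Num.truncn er^-1) => m nm.
have m0 : (0 : cplx R) < m.+1%:R by rewrite ltr0n.
apply: (@le_lt_trans _ _ (m.+1%:R^-1)).
  rewrite exprVn lef_pV2 ?posrE ?exprn_gt0// -natrX ler_nat.
  exact: ltn_expl.
have -> : (m.+1%:R^-1 : cplx R) = (m.+1%:R^-1 : R)%:C%C.
  by rewrite fmorphV rmorph_nat.
rewrite ltcR -[ltRHS]invrK ltf_pV2 ?posrE ?invr_gt0 ?ltr0n//.
apply: lt_le_trans (truncnS_gt _) _.
by rewrite ler_nat.
Qed.

Let small0 (z : A) : (forall e : cplx R, 0 < e -> `|z| < e) -> z = 0.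
Proof.
move=> h; apply/eqP; rewrite -normr_eq0; apply/negPn/negP => z0.
by have := h `|z|; rewrite lt_def normr_ge0 z0 ltxx => /(_ isT).
Qed.

Let normX (c : A) n : `|c| <= 2^-1 -> `|c ^+ n| <= 2^-1 ^+ n.
Proof.
move=> hc; elim: n => [|n ih]; first by rewrite !expr0.
rewrite !exprS; apply: le_trans (normM _ _) _.
by apply: ler_pM.
Qed.

Let neumann (c : A) :
  `|c| <= 2^-1 -> exists r, r * (1 - c) = 1 /\ (1 - c) * r = 1.
Proof.
move=> hc; pose s n : A := \sum_(i < n) c ^+ i.
have sS n : s n.+1 = s n + c ^+ n by rewrite /s big_ord_recr.
have sE n : (1 - c) * s n = 1 - c ^+ n.
  by rewrite -opprB mulNr -subrX1 opprB.
have sC n : s n * (1 - c) = (1 - c) * s n.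
  apply/commr_sym/commr_sum => i _; apply/commr_sym/commrB; first exact: commr1.
  exact/commr_sym/commrX.
have dsts n k : `|s n - s (n + k)%N| <= 2 * (2^-1 ^+ n - 2^-1 ^+ (n + k)).
  elim: k => [|k ih]; first by rewrite addn0 !subrr normr0 mulr0.
  rewrite addnS sS opprD addrA.
  apply: le_trans (ler_normB _ _) _.
  apply: le_trans (lerD ih (normX _ hc)) _.
  rewrite le_eqVlt; apply/orP; left; apply/eqP.
  by rewrite exprS; field.
have [r rP] : exists r : A, s @ \oo --> r.
  suff : cvg (s @ \oo) by move=> /cvg_ex.
  apply/cauchy_cvgP/cauchy_exP => e e0.
  have [N hN] := half_small (divr_gt0 e0 (ltr0n _ 2)).
  exists (s N); exists N => // m /= Nm.
  rewrite -ball_normE /ball_/= -(subnKC Nm).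
  apply: le_lt_trans (dsts _ _) _.
  rewrite mulrC -ltr_pdivlMr//; apply: le_lt_trans (hN N (leqnn N)).
  by rewrite lerBlDr lerDl exprn_ge0// invr_ge0 ler0n.
have lim e : 0 < e -> exists m, `|r - s m| < e /\ `|c ^+ m| < e.
  move=> e0; have [N hN] := half_small e0.
  have /cvgrPdist_lt/(_ e e0)[M _ hM] := rP.
  exists (maxn N M); split; first by apply: hM; rewrite /= leq_maxr.
  by apply: le_lt_trans (normX _ hc) (hN _ _); rewrite leq_maxl.
have bnd : 0 < `|1 - c| + 1 by rewrite ltr_wpDl.
exists r; split.
  apply/eqP; rewrite -subr_eq0; apply/eqP/small0 => e e0.
  have [m [h1 h2]] := lim _ (divr_gt0 e0 bnd).
  have -> : r * (1 - c) - 1 = (r - s m) * (1 - c) - c ^+ m.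
    by rewrite mulrBl sC sE -addrA -opprD subrK.
  apply: le_lt_trans (ler_normB _ _) _.
  apply: le_lt_trans (lerD (normM _ _) (lexx _)) _.
  rewrite -[ltRHS](divfK (lt0r_neq0 bnd)) mulrDr mulr1.
  by apply: ler_ltD => //; apply: ler_wpM2r (ltW _).
apply/eqP; rewrite -subr_eq0; apply/eqP/small0 => e e0.
have [m [h1 h2]] := lim _ (divr_gt0 e0 bnd).
have -> : (1 - c) * r - 1 = (1 - c) * (r - s m) - c ^+ m.
  by rewrite mulrBr sE -addrA -opprD subrK.
apply: le_lt_trans (ler_normB _ _) _.
apply: le_lt_trans (lerD (normM _ _) (lexx _)) _.
rewrite -[ltRHS](divfK (lt0r_neq0 bnd)) mulrDr mulr1 [(`|1 - c| * _)]mulrC.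
by apply: ler_ltD => //; apply: ler_wpM2r (ltW _).
Qed.

Let inv_uniq (a b d : A) : a * b = 1 -> b * d = 1 -> a = d.
Proof. by move=> ab bd; rewrite -[a]mulr1 -bd mulrA ab mul1r. Qed.

Variable J : closedIdeal A.

Lemma idealZ a x : x \in J -> a *: x \in J.
Proof. by move=> xJ; rewrite -[x]mul1r -starAl idealMl. Qed.

Let key (x : A) : x \in J -> `|x * star x| <= 2^-1 -> star x \in J.
Proof.
move=> xJ; set h := x * star x => hle.
have hJ : h \in J by rewrite idealMr.
have hs : star h = h by rewrite starM starK.
pose c : A := 'i *: h.
have cJ : c \in J by exact: idealZ.
have cle : `|c| <= 2^-1 by rewrite normrZ normCi mul1r.
have cs : star c = - c by rewrite starZ conjCi hs scaleNr.
have [r [rl rr]] := neumann cle.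
have rsl : star r * (1 + c) = 1.
  by have := congr1 star rr; rewrite starM starD starN star1 cs opprK.
have rc : r * c = c * r.
  have : r * (1 - c) = (1 - c) * r by rewrite rl rr.
  by rewrite mulrBr mulrBl mulr1 mul1r => /addrI/oppr_inj.
pose v : A := (1 + c) * r.
have vs : star v * v = 1.
  rewrite starM starD star1 cs -mulrA (mulrA (1 - c)).
  have -> : (1 - c) * (1 + c) = (1 + c) * (1 - c).
    by rewrite mulrBl mul1r [RHS]mulrBr mulr1 mulrDr mulrDl mulr1 mul1r.
  by rewrite -mulrA rr mulr1 rsl.
have v1 : `|v| <= 1.
  rewrite -(@ler_pXn2r _ 2) ?nnegrE// expr1n -normCS vs.
  exact: norm1_le1.
have vn n : `|v ^+ n| <= 1.
  elim: n => [|n ih]; first by rewrite expr0.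
  rewrite exprS; apply: le_trans (normM _ _) _.
  by rewrite -[leRHS]mulr1 ler_pM.
have vE : v - 1 = 2 *: (c * r).
  rewrite -[X in _ - X]rr /v -mulrBl opprB [1 + c]addrC addrACA subrr addr0.
  by rewrite -mulr2n -scaler_nat starAl.
have vJ : v - 1 \in J by rewrite vE idealZ// idealMr.
have vnJ n : v ^+ n - 1 \in J.
  elim: n => [|n ih]; first by rewrite expr0 subrr rpred0.
  have -> : v ^+ n.+1 - 1 = v * (v ^+ n - 1) + (v - 1).
    by rewrite exprS mulrBr mulr1 addrA subrK.
  by rewrite rpredD// idealMl.
have qP n : exists q : A, [/\ `|q| <= `|r|, q - 1 \in J &
    c * q = (2^-1 ^+ n.+1) *: (v ^+ (2 ^ n) - 1)].
  elim: n => [|n [q [q1 q2 q3]]].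
    exists r; split=> //.
      by rewrite -[X in _ - X]rr mulrBl mul1r opprB addrC subrK idealMr.
    by rewrite expn0 !expr1 vE scalerA mulVf ?scale1r// pnatr_eq0.
  pose w : A := 2^-1 *: (1 + v ^+ (2 ^ n)).
  exists (q * w); split.
  - apply: le_trans (normM _ _) _; rewrite -[leRHS]mulr1 ler_pM// normrZ.
    rewrite normfV normr_nat ler_pdivrMl ?ltr0n// mulr1.
    by apply: le_trans (ler_normD _ _) _; rewrite -[leRHS]/(1 + 1) lerD.
  - have -> : q * w - 1 = (q - 1) * w + (w - 1) by rewrite mulrBl mul1r addrA subrK.
    rewrite rpredD ?idealMr//.
    suff -> : w - 1 = 2^-1 *: (v ^+ (2 ^ n) - 1) by rewrite idealZ.
    rewrite /w -[X in _ - X]scale1r -[X in _ - X *: _](@mulVf _ 2) ?pnatr_eq0//.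
    rewrite -scalerA -scalerBr; congr (_ *: _).
    by rewrite scaler_nat mulr2n opprD addrA [1 + _]addrC addrK.
  - rewrite mulrA q3 starAl starAr scalerA -exprSr; congr (_ *: _).
    rewrite expnS mul2n -addnn exprD mulrBl mulrDr mulr1 mul1r.
    by rewrite [X in X - _]addrC opprD [- 1 - _]addrC addrA addrK.
apply: (@ideal_closed R A J) => B /nbhs_ballP[e /= e0 eB].
have r0 : 0 < `|r| + 1 by rewrite ltr_wpDl.
have [n hn] := half_small (divr_gt0 (exprn_gt0 2 e0) r0).
have [q [q1 q2 q3]] := qP n.
exists (- (star x * (q - 1))); split=> /=; first by rewrite rpredN idealMl.
apply: eB; rewrite -ball_normE /ball_/= opprK mulrBr mulr1 addrC subrK.
rewrite -(@ltr_pXn2r _ 2) ?nnegrE ?normr_ge0 ?ltW// -normCS starM starK.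
rewrite -mulrA (mulrA x) -/h.
have hq : `|h * q| = `|c * q| by rewrite starAl normrZ normCi mul1r.
have cq : `|c * q| <= 2^-1 ^+ n.
  rewrite q3 normrZ normrX normfV normr_nat exprSr -mulrA.
  rewrite -[leRHS]mulr1 ler_wpM2l ?exprn_ge0 ?invr_ge0 ?ler0n//.
  rewrite ler_pdivrMl ?ltr0n// mulr1.
  by apply: le_trans (ler_normB _ _) _; rewrite -[leRHS]/(1 + 1) lerD.
have sq : `|star q| <= `|r|.
  by rewrite (le_trans _ q1)// norm_star.
apply: le_lt_trans (normM _ _) _; rewrite hq.
apply: le_lt_trans (ler_pM _ _ sq cq) _ => //.
apply: (@le_lt_trans _ _ ((`|r| + 1) * 2^-1 ^+ n)).
  by rewrite ler_wpM2r ?exprn_ge0 ?invr_ge0 ?ler0n// lerDl.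
by rewrite mulrC -ltr_pdivlMr// hn.
Qed.

(* A closed two-sided ideal is self-adjoint, so the involution descends to A/J. *)
Lemma ideal_star x : x \in J -> star x \in J.
Proof.
move=> xJ; pose a : cplx R := (2 * (1 + `|x|))^-1.
have a0 : 0 < a by rewrite invr_gt0 mulr_gt0// ltr_pwDl.
have -> : star x = a^-1 *: star (a *: x).
  by rewrite starZ scalerA geC0_conj ?ltW// mulVf ?scale1r// gt_eqF.
apply/idealZ/key; first exact: idealZ.
have ax : `|a *: x| <= 2^-1.
  rewrite normrZ gtr0_norm// /a invfM -mulrA -[leRHS]mulr1 ler_wpM2l ?invr_ge0 ?ler0n//.
  by rewrite ler_pdivrMl ?ltr_pwDl// mulr1 lerDr.
apply: le_trans (normM _ _) _; rewrite norm_star.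
rewrite -[leRHS]mulr1 ler_pM// (le_trans ax)//.
by rewrite invf_le1 ?ltr0n// ler1n.
Qed.

End CStarTheory.
HB.instance Definition _ (R : realType) (A : cstarAlgType R) (J : closedIdeal A) :=
  isStarSubmod.Build R A (ClosedIdeal.sort J) (@idealZ R A J) (@ideal_star R A J).
Local Open Scope quotient_scope.

Section StarQuotient.
Variables (R : realType) (V : starLmodType R) (W : starSubmod V).

Definition squot : Type := Quotient.quot W.
HB.instance Definition _ := GRing.Zmodule.on squot.

Definition sproj (x : V) : squot := \pi_(Quotient.quot W) x.
Definition srepr (x : squot) : V := repr (x : Quotient.quot W).

Lemma sreprK x : sproj (srepr x) = x.
Proof. exact: reprK. Qed.

Lemma sproj_eq x y : (sproj x = sproj y) <-> (x - y \in W).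
Proof. by rewrite Quotient.idealrBE; split=> [/eqP|/eqP]. Qed.

Lemma sprojD : {morph sproj : x y / x + y}.
Proof. exact: Quotient.pi_add. Qed.

Let qscale (a : cplx R) (x : squot) : squot := sproj (a *: srepr x).

Let qscaleE a x : qscale a (sproj x) = sproj (a *: x).
Proof.
by apply/sproj_eq; rewrite -scalerBr star_rpredZ//; apply/sproj_eq; rewrite sreprK.
Qed.

Let qscaleA a b x : qscale a (qscale b x) = qscale (a * b) x.
Proof. by rewrite -[x]sreprK !qscaleE scalerA. Qed.

Let qscale1 : left_id 1 qscale.
Proof. by move=> x; rewrite -[x]sreprK qscaleE scale1r. Qed.

Let qscaleDr : right_distributive qscale +%R.
Proof.
move=> a x y; rewrite -[x]sreprK -[y]sreprK.
by rewrite -sprojD !qscaleE scalerDr sprojD.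
Qed.

Let qscaleDl x : {morph qscale^~ x : a b / a + b}.
Proof. by move=> a b; rewrite -[x]sreprK !qscaleE scalerDl sprojD. Qed.

HB.instance Definition _ := GRing.Zmodule_isLmodule.Build (cplx R) squot
  qscaleA qscale1 qscaleDr qscaleDl.

Lemma sprojZ a x : sproj (a *: x) = a *: sproj x.
Proof. by rewrite -qscaleE. Qed.

Lemma sproj_linear : linear sproj.
Proof. by move=> a x y; rewrite sprojD sprojZ. Qed.

HB.instance Definition _ := GRing.isLinear.Build (cplx R) V squot _ sproj sproj_linear.

Let qstar (x : squot) : squot := sproj (star (srepr x)).

Let qstarE x : qstar (sproj x) = sproj (star x).
Proof.
apply/sproj_eq; rewrite -[- _]scaleN1r -(conjCN1 (cplx R)) -starZ -starD scaleN1r.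
by rewrite star_rpred//; apply/sproj_eq; rewrite sreprK.
Qed.

Let qstarK : involutive qstar.
Proof. by move=> x; rewrite -[x]sreprK !qstarE starK. Qed.

Let qstarD : {morph qstar : x y / x + y}.
Proof.
move=> x y; rewrite -[x]sreprK -[y]sreprK.
by rewrite -sprojD !qstarE starD sprojD.
Qed.

Let qstarZ a x : qstar (a *: x) = a^* *: qstar x.
Proof. by rewrite -[x]sreprK -sprojZ !qstarE starZ sprojZ. Qed.

HB.instance Definition _ := Lmodule_hasStar.Build R squot qstarK qstarD qstarZ.

Lemma sproj_star x : sproj (star x) = star (sproj x).
Proof. by rewrite -qstarE. Qed.

End StarQuotient.

Section CStarQuotient.
Variables (R : realType) (A : cstarAlgType R) (J : closedIdeal A).

Definition cquot : Type := squot J.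
HB.instance Definition _ := StarLmodule.on cquot.
Definition cproj : A -> cquot := @sproj R A J.
HB.instance Definition _ := GRing.Linear.copy cproj (@sproj R A J).

Let cmul (x y : cquot) : cquot := cproj (srepr x * srepr y).

Let cprojP x y : cproj x = cproj y <-> x - y \in J.
Proof. exact: sproj_eq. Qed.

Let creprK (x : cquot) : cproj (srepr x) = x.
Proof. exact: sreprK. Qed.

Let cprojD : {morph cproj : x y / x + y}.
Proof. exact: sprojD. Qed.

Let cprojZ a x : cproj (a *: x) = a *: cproj x.
Proof. exact: sprojZ. Qed.

Let cmulE x y : cmul (cproj x) (cproj y) = cproj (x * y).
Proof.
apply/cprojP; set x' := srepr _; set y' := srepr _.
have -> : x' * y' - x * y = (x' - x) * y' + x * (y' - y).
  by rewrite mulrBl mulrBr addrA subrK.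
by apply: rpredD; [apply: idealMr|apply: idealMl]; apply/cprojP; rewrite creprK.
Qed.

Let cmulA : associative cmul.
Proof.
by move=> x y z; rewrite -[x]creprK -[y]creprK -[z]creprK !cmulE mulrA.
Qed.

Let cmul1l : left_id (cproj 1) cmul.
Proof. by move=> x; rewrite -[x]creprK cmulE mul1r. Qed.

Let cmul1r : right_id (cproj 1) cmul.
Proof. by move=> x; rewrite -[x]creprK cmulE mulr1. Qed.

Let cmulDl : left_distributive cmul +%R.
Proof.
move=> x y z; rewrite -[x]creprK -[y]creprK -[z]creprK.
by rewrite -cprojD !cmulE mulrDl cprojD.
Qed.

Let cmulDr : right_distributive cmul +%R.
Proof.
move=> x y z; rewrite -[x]creprK -[y]creprK -[z]creprK.
by rewrite -cprojD !cmulE mulrDr cprojD.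
Qed.

Let cmulZl (a : cplx R) (x y : cquot) : cmul (a *: x) y = a *: cmul x y.
Proof.
by rewrite -[x]creprK -[y]creprK -cprojZ !cmulE starAl cprojZ.
Qed.

Let cmulZr (a : cplx R) (x y : cquot) : cmul x (a *: y) = a *: cmul x y.
Proof.
by rewrite -[x]creprK -[y]creprK -cprojZ !cmulE starAr cprojZ.
Qed.

Lemma cproj_star x : star (cproj x) = cproj (star x).
Proof. by rewrite /cproj sproj_star. Qed.

Let star_cmul (x y : cquot) : star (cmul x y) = cmul (star y) (star x).
Proof.
by rewrite -[x]creprK -[y]creprK cmulE !cproj_star cmulE starM.
Qed.

HB.instance Definition _ := isStarAlgebra.Build R cquot
  cmulA cmul1l cmul1r cmulDl cmulDr cmulZl cmulZr star_cmul.

Lemma cproj1 : cproj 1 = sone. Proof. by []. Qed.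

Lemma cprojM x y : cproj (x * y) = smul (cproj x) (cproj y).
Proof. by rewrite -cmulE. Qed.

End CStarQuotient.

Section StarSub.
Variables (R : realType) (V : starLmodType R) (W : starSubmod V).

Definition ssub : Type := {x : V | x \in W}.
HB.instance Definition _ := SubChoice.on ssub.

Let ssub_closed : submod_closed W.
Proof.
split=> [|a x y xW yW]; first exact: rpred0.
by rewrite rpredD// star_rpredZ.
Qed.

HB.instance Definition _ :=
  GRing.SubChoice_isSubLmodule.Build (cplx R) V (mem W) ssub ssub_closed.

Let sstar (x : ssub) : ssub := Sub (star (val x)) (star_rpred _ (valP x)).

Let sstarK : involutive sstar.
Proof. by move=> x; apply: val_inj; rewrite /= starK. Qed.

Let sstarD : {morph sstar : x y / x + y}.
Proof. by move=> x y; apply: val_inj; rewrite /= starD. Qed.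

Let sstarZ a (x : ssub) : sstar (a *: x) = a^* *: sstar x.
Proof. by apply: val_inj; rewrite /= starZ. Qed.

HB.instance Definition _ := Lmodule_hasStar.Build R ssub sstarK sstarD sstarZ.

End StarSub.

Definition lspan (K : pzRingType) (V : lmodType K) (X : set V) : {pred V} :=
  fun v => `[< exists2 s : seq (K * V),
    forall p, p \in s -> X p.2 & v = \sum_(p <- s) p.1 *: p.2 >].

Section Span.
Variables (K : pzRingType) (V : lmodType K) (X : set V).

Lemma lspanP v : reflect (exists2 s : seq (K * V),
  forall p, p \in s -> X p.2 & v = \sum_(p <- s) p.1 *: p.2) (v \in lspan X).
Proof. exact: asboolP. Qed.

Lemma mem_lspan v : X v -> v \in lspan X.
Proof.
move=> Xv; apply/lspanP; exists [:: (1, v)]; last by rewrite big_seq1 scale1r.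
by move=> p; rewrite inE => /eqP ->.
Qed.

Lemma lspanZ a v : v \in lspan X -> a *: v \in lspan X.
Proof.
move=> /lspanP[s sX ->]; apply/lspanP; exists [seq (a * p.1, p.2) | p <- s].
  by move=> _ /mapP[p /sX Xp ->].
rewrite big_map scaler_sumr; apply: eq_bigr => p _; by rewrite scalerA.
Qed.

Let lspan_zmod : zmod_closed (lspan X).
Proof.
split; first by apply/lspanP; exists [::] => //; rewrite big_nil.
move=> u v uX; rewrite -scaleN1r => /(lspanZ (-1)).
move: uX => /lspanP[s sX ->] /lspanP[t tX ->].
apply/lspanP; exists (s ++ t); last by rewrite big_cat.
by move=> p; rewrite mem_cat => /orP[/sX|/tX].
Qed.

HB.instance Definition _ := GRing.isZmodClosed.Build V (lspan X) lspan_zmod.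

End Span.

Lemma lspan_star (R : realType) (V : starLmodType R) (X : set V) :
  (forall x, X x -> X (star x)) -> forall v, v \in lspan X -> star v \in lspan X.
Proof.
move=> Xs v /lspanP[s sX ->]; apply/lspanP.
exists [seq (p.1^*, star p.2) | p <- s].
  by move=> _ /mapP[p /sX Xp ->]; exact: Xs.
rewrite big_map; elim: s {sX} => [|p s ih]; last by rewrite !big_cons starD starZ ih.
by rewrite !big_nil star0.
Qed.

Section DirectSum.
Variables (R : realType) (L : choiceType) (S : L -> starLmodType R).

Definition dprod : Type := forall l, S l.
HB.instance Definition _ := gen_eqMixin dprod.
HB.instance Definition _ := gen_choiceMixin dprod.

Lemma dprodP (f g : dprod) : (forall l, f l = g l) -> f = g.
Proof. exact: functional_extensionality_dep. Qed.

Let dadd (f g : dprod) : dprod := fun l => f l + g l.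
Let dopp (f : dprod) : dprod := fun l => - f l.
Let dzero : dprod := fun l => 0.
Let daddA : associative dadd.
Proof. by move=> f g h; apply: dprodP => l; exact: addrA. Qed.
Let daddC : commutative dadd.
Proof. by move=> f g; apply: dprodP => l; exact: addrC. Qed.
Let dadd0 : left_id dzero dadd.
Proof. by move=> f; apply: dprodP => l; exact: add0r. Qed.
Let daddN : left_inverse dzero dopp dadd.
Proof. by move=> f; apply: dprodP => l; exact: addNr. Qed.
HB.instance Definition _ := GRing.isZmodule.Build dprod daddA daddC dadd0 daddN.

Let dscale (a : cplx R) (f : dprod) : dprod := fun l => a *: f l.
Let dscaleA a b f : dscale a (dscale b f) = dscale (a * b) f.
Proof. by apply: dprodP => l; exact: scalerA. Qed.
Let dscale1 : left_id 1 dscale.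
Proof. by move=> f; apply: dprodP => l; exact: scale1r. Qed.
Let dscaleDr : right_distributive dscale +%R.
Proof. by move=> a f g; apply: dprodP => l; exact: scalerDr. Qed.
Let dscaleDl f : {morph dscale^~ f : a b / a + b}.
Proof. by move=> a b; apply: dprodP => l; exact: scalerDl. Qed.
HB.instance Definition _ := GRing.Zmodule_isLmodule.Build (cplx R) dprod
  dscaleA dscale1 dscaleDr dscaleDl.

Let dstar (f : dprod) : dprod := fun l => star (f l).
Let dstarK : involutive dstar.
Proof. by move=> f; apply: dprodP => l; exact: starK. Qed.
Let dstarD : {morph dstar : f g / f + g}.
Proof. by move=> f g; apply: dprodP => l; exact: starD. Qed.
Let dstarZ (a : cplx R) f : dstar (a *: f) = a^* *: dstar f.
Proof. by apply: dprodP => l; exact: starZ. Qed.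
HB.instance Definition _ := Lmodule_hasStar.Build R dprod dstarK dstarD dstarZ.

Definition fin_support : {pred dprod} :=
  fun f => `[< finite_set [set l | f l != 0] >].

Let fin_supportZ (a : cplx R) f : f \in fin_support -> a *: f \in fin_support.
Proof.
move=> /asboolP ff; apply/asboolP; apply: sub_finite_set ff => l /=.
by apply: contra => /eqP fl; rewrite -[X in X == _]/(a *: f l) fl scaler0.
Qed.

Let fin_support_star f : f \in fin_support -> star f \in fin_support.
Proof.
move=> /asboolP ff; apply/asboolP; apply: sub_finite_set ff => l /=.
by apply: contra => /eqP fl; rewrite -[X in X == _]/(star (f l)) fl star0.
Qed.

Let fin_support_zmod : zmod_closed fin_support.
Proof.
split.
  by apply/asboolP; apply: sub_finite_set (finite_set0 L) => l /=; rewrite eqxx.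
move=> f g /asboolP ff /asboolP fg; apply/asboolP.
have fU : finite_set ([set l | f l != 0] `|` [set l | g l != 0]).
  by rewrite finite_setU.
apply: sub_finite_set fU => l /= fgl.
have [fl|] := eqVneq (f l) 0; last by left.
by right; move: fgl; rewrite -[X in X != _]/(f l - g l) fl sub0r oppr_eq0.
Qed.

HB.instance Definition _ :=
  GRing.isZmodClosed.Build dprod fin_support fin_support_zmod.
HB.instance Definition _ :=
  isStarSubmod.Build R dprod fin_support fin_supportZ fin_support_star.

Definition dsum : Type := ssub fin_support.
HB.instance Definition _ := StarLmodule.on dsum.

Definition dinj_fun l (x : S l) : dprod := dfwith (fun m => 0 : S m) x.

Lemma dinj_subproof l (x : S l) : dinj_fun x \in fin_support.
Proof.
apply/asboolP; apply: sub_finite_set (finite_set1 l) => m /=.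
by rewrite /dinj_fun; case: dfwithP => // m' _; rewrite eqxx.
Qed.

Definition dinj l (x : S l) : dsum := Sub (dinj_fun x) (dinj_subproof x).

End DirectSum.

(* The data of an abstract operator system: matrix cones and a unit on a *-vector
   space.  The Choi-Effros order axioms are not recorded: unital complete
   positivity and the coproduct only refer to the data. *)
Record mouSpace (R : realType) := MouSpace {
  mou_sort :> starLmodType R;
  mou_pos : forall n : nat, set 'M[mou_sort]_n;
  mou_unit : mou_sort;
  mou_unit_star : star mou_unit = mou_unit }.

(* The copy a (x) 1 of a in M_n (x) C1, inside M_n(S). *)
Definition unit_mx (R : realType) (S : mouSpace R) (n : nat)
  (a : 'M[cplx R]_n) : 'M[S]_n := map_mx (fun z => z *: mou_unit S) a.

Definition ucp (R : realType) (S T : mouSpace R) (f : {linear S -> T}) : Prop :=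
  f (mou_unit S) = mou_unit T /\
  forall (n : nat) (x : 'M[S]_n), mou_pos x -> mou_pos (map_mx f x).

Definition state (R : realType) (S : mouSpace R) (n : nat)
    (w : 'M[S]_n -> cplx R) : Prop :=
  [/\ forall (a : cplx R) (x y : 'M[S]_n),
        w (map_mx ( *:%R a) x + y) = a * w x + w y,
      forall x, mou_pos x -> 0 <= w x
    & w (unit_mx S 1%:M) = 1].

Definition adjmx (R : realType) (V : starLmodType R) (m n : nat)
  (x : 'M[V]_(m, n)) : 'M[V]_(n, m) := (map_mx star x)^T.

(* Positive elements of M_n(A): those of the form b^* b with b in M_n(A). *)
Definition staralg_mou (R : realType) (A : starAlgType R) : mouSpace R :=
  @MouSpace R A (fun n => [set x | exists b : 'M[A]_n, x = adjmx b *m b])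
    1 (star1 A).

Lemma sub_unit_star (R : realType) (S : mouSpace R) (W : starSubmod S)
    (W1 : mou_unit S \in W) :
  star (Sub (mou_unit S) W1 : ssub W) = Sub (mou_unit S) W1.
Proof. by apply: val_inj; exact: mou_unit_star. Qed.

Definition sub_mou (R : realType) (S : mouSpace R) (W : starSubmod S)
    (W1 : mou_unit S \in W) : mouSpace R :=
  @MouSpace R (ssub W) (fun n => [set x : 'M[ssub W]_n | mou_pos (map_mx val x)])
    (Sub (mou_unit S) W1) (sub_unit_star W1).

Section Coproduct.
Variables (R : realType) (L : choiceType) (S : L -> mouSpace R).

(* The differences n_l - n_m that are divided out of the direct sum. *)
Definition unit_diff : set (dsum S) :=
  [set d | exists l m : L,
    d = @dinj R L S l (mou_unit (S l)) - @dinj R L S m (mou_unit (S m))].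

Definition unit_rel : {pred dsum S} := lspan unit_diff.

HB.instance Definition _ := GRing.ZmodClosed.on unit_rel.

Let dinj_star l (x : S l) : star (@dinj R L S l x) = @dinj R L S l (star x).
Proof.
apply: val_inj; apply: dprodP => m /=; rewrite /dinj_fun.
rewrite -[LHS]/(star (dfwith _ x m)).
by case: dfwithP => [|m' lm]; rewrite ?dfwith_in // dfwith_out ?star0.
Qed.

Let unit_rel_star x : x \in unit_rel -> star x \in unit_rel.
Proof.
apply: lspan_star => _ [l [m ->]]; exists l, m.
by rewrite starD starN !dinj_star !mou_unit_star.
Qed.

HB.instance Definition _ :=
  isStarSubmod.Build R (dsum S) unit_rel (@lspanZ _ _ _) unit_rel_star.

Definition coprod_carrier : starLmodType R := squot unit_rel.
Definition coprod_in l (x : S l) : coprod_carrier :=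
  sproj unit_rel (@dinj R L S l x).

Lemma coprod_in_star l (x : S l) : coprod_in (star x) = star (coprod_in x).
Proof. by rewrite /coprod_in -dinj_star sproj_star. Qed.

(* The common class of the n_l; see coprod_unitE.  The default 0 is only reached
   for an empty family. *)
Definition coprod_unit : coprod_carrier :=
  xget 0 [set coprod_in (mou_unit (S l)) | l in setT].

Lemma coprod_unit_star : star coprod_unit = coprod_unit.
Proof.
rewrite /coprod_unit; case: xgetP => [_ _ [l _ <-]|_]; last exact: star0.
by rewrite -coprod_in_star mou_unit_star.
Qed.

(* A matrix over the coproduct has many expressions as a finite sum of x_l; two of
   them differ by terms a_l (x) 1 with total a_l equal to 0, on which compatible
   states sum to 0. *)
Definition coprod_pos (n : nat) : set 'M[coprod_carrier]_n :=
  [set X | exists (F : {fset L}) (x : forall l, 'M[S l]_n),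
    X = \sum_(l <- F) map_mx (@coprod_in l) (x l) /\
    forall w : forall l, 'M[S l]_n -> cplx R,
      (forall l, l \in F -> state (w l)) ->
      (forall l m, l \in F -> m \in F -> forall a : 'M[cplx R]_n,
        w l (unit_mx (S l) a) = w m (unit_mx (S m) a)) ->
      0 <= \sum_(l <- F) w l (x l)].

Definition coprod : mouSpace R :=
  @MouSpace R coprod_carrier coprod_pos coprod_unit coprod_unit_star.

Lemma coprod_unitE l : coprod_unit = coprod_in (mou_unit (S l)).
Proof.
rewrite /coprod_unit; case: xgetP => [_ _ [m _ <-]|/(_ (coprod_in (mou_unit (S l))))[]]; last by exists l.
apply/sproj_eq/lspanP; exists [:: (1, @dinj R L S m (mou_unit (S m)) - @dinj R L S l (mou_unit (S l)))].
  by move=> p; rewrite inE => /eqP ->; exists m, l.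
by rewrite big_seq1 scale1r.
Qed.

End Coproduct.

Section ContinuousFunctions.
Variable R : realType.

Definition unitI : Type := set_type `[0, 1 : R]%classic.
HB.instance Definition _ := Topological.on unitI.

Definition cts : {pred unitI -> cplx R} := fun f => `[< continuous f >].
Definition C01 : Type := {f : unitI -> cplx R | f \in cts}.
HB.instance Definition _ := SubChoice.on C01.

Let ctsP f : reflect (continuous f) (f \in cts).
Proof. exact: asboolP. Qed.

Let cts_closed : submod_closed cts.
Proof.
split=> [|a f g /ctsP cf /ctsP cg]; apply/ctsP => x; first exact: (@cst_continuous unitI (cplx R) 0).
apply: (@continuousD _ _ _ (fun z => a * f z) g); last exact: cg.
by apply: continuousM; [exact: cst_continuous|exact: cf].
Qed.

HB.instance Definition _ :=
  GRing.SubChoice_isSubLmodule.Build (cplx R) (unitI -> cplx R) (mem cts) C01 cts_closed.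

Let cts_conj (f : C01) : (fun x => (val f x)^* ) \in cts.
Proof.
apply/ctsP => x; apply/(@cvgrPdist_lt _ _ _ _ (@nbhs_filter unitI x)) => e e0.
have /(@cvgrPdist_lt _ _ _ _ (@nbhs_filter unitI x))/(_ e e0) := ctsP _ (valP f) x.
by apply: (@filterS _ _ (@nbhs_filter unitI x)) => z; rewrite -rmorphB norm_conjC.
Qed.
Let cts_mul (f g : C01) : (fun x => val f x * val g x) \in cts.
Proof.
by apply/ctsP => x; apply: continuousM; [exact: (ctsP _ (valP f))|exact: (ctsP _ (valP g))].
Qed.
Let cts_cst (a : cplx R) : (fun=> a) \in cts.
Proof. by apply/ctsP; exact: cst_continuous. Qed.

Let mkC01 f (cf : f \in cts) : C01 := exist _ f cf.
Definition C01_cst a : C01 := mkC01 (cts_cst a).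
Let cstar (f : C01) : C01 := mkC01 (cts_conj f).
Let cmul (f g : C01) : C01 := mkC01 (cts_mul f g).

Let C01P (f g : C01) : (forall x, val f x = val g x) -> f = g.
Proof. by move=> fg; apply/val_inj/funext. Qed.

Let cstarK : involutive cstar.
Proof. by move=> f; apply: C01P => x /=; rewrite conjCK. Qed.
Let cstarD : {morph cstar : f g / f + g}.
Proof. by move=> f g; apply: C01P => x /=; rewrite rmorphD. Qed.
Let cstarZ a f : cstar (a *: f) = a^* *: cstar f.
Proof. by apply: C01P => x /=; rewrite rmorphM. Qed.
HB.instance Definition _ := Lmodule_hasStar.Build R C01 cstarK cstarD cstarZ.

Let cmulA : associative cmul.
Proof. by move=> f g h; apply: C01P => x /=; rewrite mulrA. Qed.
Let cmul1l : left_id (C01_cst 1) cmul.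
Proof. by move=> f; apply: C01P => x /=; rewrite mul1r. Qed.
Let cmul1r : right_id (C01_cst 1) cmul.
Proof. by move=> f; apply: C01P => x /=; rewrite mulr1. Qed.
Let cmulDl : left_distributive cmul +%R.
Proof. by move=> f g h; apply: C01P => x /=; rewrite mulrDl. Qed.
Let cmulDr : right_distributive cmul +%R.
Proof. by move=> f g h; apply: C01P => x /=; rewrite mulrDr. Qed.
Let cmulZl (a : cplx R) (f g : C01) : cmul (a *: f) g = a *: cmul f g.
Proof. by apply: C01P => x /=; rewrite -[LHS]mulrA. Qed.
Let cmulZr (a : cplx R) (f g : C01) : cmul f (a *: g) = a *: cmul f g.
Proof. by apply: C01P => x /=; rewrite [LHS]mulrCA. Qed.
Let star_cmul (f g : C01) : star (cmul f g) = cmul (star g) (star f).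
Proof. by apply: C01P => x /=; rewrite rmorphM mulrC. Qed.
HB.instance Definition _ := isStarAlgebra.Build R C01
  cmulA cmul1l cmul1r cmulDl cmulDr cmulZl cmulZr star_cmul.

Let cts_coord : (fun x : unitI => (sval x)%:C%C : cplx R) \in cts.
Proof.
apply/ctsP => x; apply/(@cvgrPdist_lt _ _ _ _ (@nbhs_filter unitI x)) => -[e ei].
rewrite ltcE /= => /andP[/eqP -> e0].
have /(@cvgrPdist_lt _ _ _ _ (@nbhs_filter unitI x))/(_ e e0) : (set_val : unitI -> R) z @[z --> x] --> (set_val x : R).
  exact: initial_continuous.
apply: (@filterS _ _ (@nbhs_filter unitI x)) => z.
by rewrite -rmorphB normc_def /= expr0n addr0 sqrtr_sqr ltcR.
Qed.
Definition C01_coord : C01 := mkC01 cts_coord.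

Lemma star_C01_coord : star C01_coord = C01_coord.
Proof.
apply: C01P => x /=; apply: conj_Creal.
by rewrite realE !lecE /= eqxx /= le_total.
Qed.

End ContinuousFunctions.

Section MatrixAlgebra.
Variables (R : realType) (B : starAlgType R) (k : nat).

Definition mxalg : Type := 'M[B]_k.
HB.instance Definition _ := GRing.Zmodule.on mxalg.
Implicit Types (a : cplx R) (x y : mxalg).

Let mscale a x : mxalg := map_mx ( *:%R a) x.
Let mscaleA a b x : mscale a (mscale b x) = mscale (a * b) x.
Proof. by apply/matrixP => i j; rewrite !mxE scalerA. Qed.
Let mscale1 : left_id 1 mscale.
Proof. by move=> x; apply/matrixP => i j; rewrite !mxE scale1r. Qed.
Let mscaleDr : right_distributive mscale +%R.
Proof. by move=> a x y; apply/matrixP => i j; rewrite !mxE scalerDr. Qed.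
Let mscaleDl x : {morph mscale^~ x : a b / a + b}.
Proof. by move=> a b; apply/matrixP => i j; rewrite !mxE scalerDl. Qed.
HB.instance Definition _ := GRing.Zmodule_isLmodule.Build (cplx R) mxalg
  mscaleA mscale1 mscaleDr mscaleDl.

Let mstar x : mxalg := adjmx (x : 'M[B]_k).
Let mstarK : involutive mstar.
Proof. by move=> x; apply/matrixP => i j; rewrite !mxE starK. Qed.
Let mstarD : {morph mstar : x y / x + y}.
Proof. by move=> x y; apply/matrixP => i j; rewrite !mxE starD. Qed.
Let mstarZ a x : mstar (a *: x) = a^* *: mstar x.
Proof. by apply/matrixP => i j; rewrite !mxE starZ. Qed.
HB.instance Definition _ := Lmodule_hasStar.Build R mxalg mstarK mstarD mstarZ.

Let mmul x y : mxalg := (x : 'M[B]_k) *m (y : 'M[B]_k).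
Let mmulA : associative mmul. Proof. exact: mulmxA. Qed.
Let mmul1l : left_id (1%:M : 'M[B]_k) mmul. Proof. exact: mul1mx. Qed.
Let mmul1r : right_id (1%:M : 'M[B]_k) mmul. Proof. exact: mulmx1. Qed.
Let mmulDl : left_distributive mmul +%R.
Proof. by move=> x y z; exact: mulmxDl. Qed.
Let mmulDr : right_distributive mmul +%R.
Proof. by move=> x y z; exact: mulmxDr. Qed.
Let mmulZl a x y : mmul (a *: x) y = a *: mmul x y.
Proof.
apply/matrixP => i j; rewrite !mxE scaler_sumr.
by apply: eq_bigr => l _; rewrite !mxE starAl.
Qed.
Let mmulZr a x y : mmul x (a *: y) = a *: mmul x y.
Proof.
apply/matrixP => i j; rewrite !mxE scaler_sumr.
by apply: eq_bigr => l _; rewrite !mxE starAr.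
Qed.
Let star_mmul x y : star (mmul x y) = mmul (star y) (star x).
Proof.
apply/matrixP => i j; rewrite !mxE.
rewrite (big_morph _ (@starD R B) (star0 B)).
by apply: eq_bigr => l _; rewrite !mxE starM.
Qed.
HB.instance Definition _ := isStarAlgebra.Build R mxalg
  mmulA mmul1l mmul1r mmulDl mmulDr mmulZl mmulZr star_mmul.

(* e_ij (x) f *)
Definition mxunit (i j : 'I_k) (f : B) : mxalg :=
  \matrix_(p, q) (f *+ ((p == i) && (q == j))).

Lemma star_mxunit i j f : star (mxunit i j f) = mxunit j i (star f).
Proof.
apply/matrixP => p q; rewrite !mxE andbC.
by case: (_ && _); rewrite ?mulr1n// !mulr0n star0.
Qed.

End MatrixAlgebra.

Section Ck.
Variables (R : realType) (k : nat).

Definition Ck_gen : set (mxalg (C01 R) k) :=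
  [set x | exists i j, x = mxunit i j 1 \/ x = mxunit i j (C01_coord R)].

Definition Ck_span : {pred mxalg (C01 R) k} := lspan Ck_gen.
HB.instance Definition _ := GRing.ZmodClosed.on Ck_span.

Let Ck_span_star x : x \in Ck_span -> star x \in Ck_span.
Proof.
apply: lspan_star => _ [i [j [|] ->]]; exists j, i; rewrite star_mxunit.
  by left; rewrite star1.
by right; rewrite star_C01_coord.
Qed.

HB.instance Definition _ :=
  isStarSubmod.Build R (mxalg (C01 R) k) Ck_span (@lspanZ _ _ _) Ck_span_star.

Lemma Ck_span1 : mou_unit (staralg_mou (mxalg (C01 R) k)) \in Ck_span.
Proof.
have -> : mou_unit (staralg_mou (mxalg (C01 R) k)) = \sum_(i < k) mxunit i i 1.
  apply/matrixP => p q; rewrite summxE !mxE (bigD1 p)//= mxE eqxx/= big1 ?addr0.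
    by rewrite eq_sym.
  by move=> i ip; rewrite mxE eq_sym (negPf ip).
by apply: rpred_sum => i _; apply: mem_lspan; exists i, i; left.
Qed.

Definition Ck : mouSpace R := sub_mou Ck_span1.

End Ck.

(* Index sets of all the summands: (k, i) with i in I_ k stands for a copy of
   Ck (k.+1), so I_ k is the index set of the summands of matrix size k.+1. *)
Definition C_I (R : realType) (I_ : nat -> choiceType) : mouSpace R :=
  coprod (fun l : {k : nat & I_ k} => Ck R (tag l).+1).

(* Main.v *)
Require Import Defs.
From HB Require Import structures.
From mathcomp Require Import all_boot all_order all_algebra finmap complex.
From mathcomp Require Import boolp classical_sets functions cardinality fsbigop.
From mathcomp Require Import reals topology normedtype realfun.
From mathcomp Require Import ring lra.
Set Implicit Arguments.
Unset Strict Implicit.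
Unset Printing Implicit Defensive.
Import Order.TTheory GRing.Theory Num.Theory.
Import numFieldNormedType.Exports.
Local Open Scope ring_scope.
Local Open Scope classical_set_scope.

(* Restricting phi to a summand reduces the theorem to lifting unital completely
   positive maps on each C_k and gluing the lifts.

   Lifting.  C_k is M_k (x) span(1 - t, t), so phi on C_k is given by two positive
   matrices P, Q over A/J, the images of (e_ij (x) t) and (e_ij (x) (1 - t)), with
   sum_i (P_ii + Q_ii) = 1.  Writing P = d^* d and lifting d gives positive lifts
   P0, Q0 over A whose trace s = sum_i (P0_ii + Q0_ii) is only 1 modulo J.  With
   c = 2 (1 + s)^-1, which is 1 modulo J, one has 1 - c s c = (1 - c)^2, so that
   c P0 c and c Q0 c + (1 - c)^2 e_00 are positive lifts with trace exactly 1.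

   Gluing.  A state of M_n(A) pulls back along the lifts to a compatible family of
   states, so it remains to see that an element of M_n(A) on which all positive
   functionals are nonnegative is of the form b^* b.  M_n(A) is normed by
   ||x||^2 = sup f(x^* x)/f(1) over positive functionals f, which is equivalent to
   the norm of the entries, because A has norming positive functionals.  That in
   turn rests on Kaplansky's theorem that a^* a is positive in A.  Both A and M_n(A)
   are then complete for a submultiplicative norm, which is enough to take square
   roots of r - y for ||y|| <= r. *)

(* [ncring] decides equalities that hold in the free ring on the atoms: both sides
   are expanded into signed words. *)
Section NonCommutativeRing.

Inductive ncexpr : Type :=
  | NCvar of nat | NC0 | NC1 | NCadd of ncexpr & ncexpr
  | NCopp of ncexpr | NCmul of ncexpr & ncexpr.

(** Repeated words are kept as separate entries; [nccoef] adds up their coefficients when two sides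
    are compared. *)
Fixpoint ncnorm (e : ncexpr) : seq (int * seq nat) :=
  match e with
  | NCvar i => [:: (1, [:: i])]
  | NC0 => [::]
  | NC1 => [:: (1, [::])]
  | NCadd a b => ncnorm a ++ ncnorm b
  | NCopp a => [seq (- m.1, m.2) | m <- ncnorm a]
  | NCmul a b => [seq (m.1 * p.1, m.2 ++ p.2) | m <- ncnorm a, p <- ncnorm b]
  end.

Definition nccoef (s : seq (int * seq nat)) (w : seq nat) : int :=
  foldr (fun m c => if m.2 == w then m.1 + c else c) 0 s.

Definition ncequal (e f : ncexpr) : bool :=
  all (fun w => nccoef (ncnorm e) w == nccoef (ncnorm f) w)
    (undup (map snd (ncnorm e ++ ncnorm f))).

Variables (T : pzRingType) (env : seq T).

Fixpoint nceval (e : ncexpr) : T :=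
  match e with
  | NCvar i => nth 0 env i
  | NC0 => 0
  | NC1 => 1
  | NCadd a b => nceval a + nceval b
  | NCopp a => - nceval a
  | NCmul a b => nceval a * nceval b
  end.

Let word (w : seq nat) : T := \prod_(i <- w) nth 0 env i.
Let total (s : seq (int * seq nat)) : T := \sum_(m <- s) word m.2 *~ m.1.

Let ncnormE e : nceval e = total (ncnorm e).
Proof.
rewrite /total; elim: e => [i|||a ha b hb|a ha|a ha b hb] /=; rewrite ?ha ?hb.
- by rewrite big_seq1 mulr1z /word big_seq1.
- by rewrite big_nil.
- by rewrite big_seq1 mulr1z /word big_nil.
- by rewrite big_cat.
- by rewrite big_map -sumrN; apply: eq_bigr => m _; rewrite mulrNz.
- rewrite big_allpairs_dep mulr_suml; apply: eq_bigr => m _.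
  rewrite mulr_sumr; apply: eq_bigr => p _ /=.
  by rewrite /word big_cat /= mulrzAl mulrzAr -mulrzA mulrC.
Qed.

Let totalE s (W : seq (seq nat)) : uniq W -> {subset map snd s <= W} ->
  total s = \sum_(w <- W) word w *~ nccoef s w.
Proof.
move=> uW; rewrite /total; elim: s => [|m s ih] sW.
  by rewrite big_nil big1// => w _; rewrite mulr0z.
rewrite big_cons ih; last by move=> w ws; apply: sW; rewrite inE ws orbT.
have mW : m.2 \in W by apply: sW; rewrite inE eqxx.
rewrite !(perm_big _ (perm_to_rem mW)) /= !big_cons /= eqxx addrA -mulrzDr.
congr (_ + _); rewrite big_seq [RHS]big_seq; apply: eq_bigr => w.
by rewrite mem_rem_uniq// inE /= => /andP[/negPf]; rewrite eq_sym => ->.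
Qed.

Lemma nc_sound e f : ncequal e f -> nceval e = nceval f.
Proof.
move=> /allP ef; rewrite !ncnormE.
rewrite !(totalE (undup_uniq (map snd (ncnorm e ++ ncnorm f)))).
- by rewrite big_seq [RHS]big_seq; apply: eq_bigr => w /ef /eqP ->.
- by move=> w ws; rewrite mem_undup map_cat mem_cat ws orbT.
- by move=> w ws; rewrite mem_undup map_cat mem_cat ws.
Qed.

End NonCommutativeRing.

(** The [match goal] makes the unification run while the calling tactic is still computing a term.
    Atoms are thus identified up to unification. *)
Ltac nc_unify x y := match goal with _ => unify x y end.

Ltac nc_mem x l :=
  lazymatch l with
  | nil => constr:(false)
  | cons ?y ?l' => match constr:(tt) with
      | _ => let _ := nc_unify x y in constr:(true)
      | _ => nc_mem x l'
      end
  end.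

Ltac nc_index x l :=
  lazymatch l with
  | cons ?y ?l' => match constr:(tt) with
      | _ => let _ := nc_unify x y in constr:(O)
      | _ => let i := nc_index x l' in constr:(S i)
      end
  end.

Ltac nc_env e l :=
  lazymatch e with
  | (?a + ?b)%R => let l1 := nc_env a l in nc_env b l1
  | (?a * ?b)%R => let l1 := nc_env a l in nc_env b l1
  | (- ?a)%R => nc_env a l
  | 0%R => constr:(l)
  | 1%R => constr:(l)
  | ?x => lazymatch nc_mem x l with
          | true => constr:(l)
          | false => constr:(x :: l)
          end
  end.

Ltac nc_reify e l :=
  lazymatch e with
  | (?a + ?b)%R => let a' := nc_reify a l in let b' := nc_reify b l in constr:(NCadd a' b')
  | (?a * ?b)%R => let a' := nc_reify a l in let b' := nc_reify b l in constr:(NCmul a' b')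
  | (- ?a)%R => let a' := nc_reify a l in constr:(NCopp a')
  | 0%R => constr:(NC0)
  | 1%R => constr:(NC1)
  | ?x => let i := nc_index x l in constr:(NCvar i)
  end.

Ltac ncring :=
  lazymatch goal with
  | |- @eq ?T ?a ?b =>
    let l0 := nc_env a (@nil T) in
    let l := nc_env b l0 in
    let a' := nc_reify a l in
    let b' := nc_reify b l in
    refine (@nc_sound _ l a' b' _); vm_compute; reflexivity
  end.

(** * Limits and square roots in a complete algebra bound *)

Section RealScalars.
Variable R : realType.

Definition cR (r : R) : cplx R := r%:C%C.

Lemma cR0 : cR 0 = 0. Proof. exact: (rmorph0 (real_complex R)). Qed.
Lemma cR1 : cR 1 = 1. Proof. exact: (rmorph1 (real_complex R)). Qed.
Lemma cRD r s : cR (r + s) = cR r + cR s. Proof. exact: (rmorphD (real_complex R)). Qed.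
Lemma cRN r : cR (- r) = - cR r. Proof. exact: (rmorphN (real_complex R)). Qed.
Lemma cRB r s : cR (r - s) = cR r - cR s. Proof. exact: (rmorphB (real_complex R)). Qed.
Lemma cRM r s : cR (r * s) = cR r * cR s. Proof. exact: (rmorphM (real_complex R)). Qed.
Lemma cRX r n : cR (r ^+ n) = cR r ^+ n. Proof. exact: (rmorphXn (real_complex R)). Qed.

Lemma cR_inj : injective cR.
Proof. exact: (fmorph_inj (real_complex R)). Qed.

Lemma cR_le r s : (cR r <= cR s) = (r <= s).
Proof. exact: lecR. Qed.

Lemma cR_lt r s : (cR r < cR s) = (r < s).
Proof. exact: ltcR. Qed.

Lemma cR_ge0 r : (0 <= cR r) = (0 <= r).
Proof. by rewrite -cR0 cR_le. Qed.

Lemma cR_gt0 r : (0 < cR r) = (0 < r).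
Proof. by rewrite -cR0 cR_lt. Qed.

Lemma cR_conj r : (cR r)^* = cR r.
Proof. by apply: conj_Creal; rewrite realE -cR0 !cR_le le_total. Qed.

Lemma cR_norm r : `|cR r| = cR `|r|.
Proof. by rewrite normc_def /= expr0n addr0 sqrtr_sqr. Qed.

Lemma mulii : 'i * 'i = -1 :> cplx R.
Proof. by rewrite -expr2 sqrCi. Qed.

Lemma cplxE (a : cplx R) : a = cR (complex.Re a) + 'i * cR (complex.Im a).
Proof.
case: a => a b; apply/eqP.
by rewrite eq_complex /= !mul0r !mul1r !add0r !subr0 ?addr0 !eqxx.
Qed.

End RealScalars.

Section RealScaling.
Variables (R : realType) (B : starAlgType R).
Implicit Types (x y : B) (r s : R).

Lemma starB x y : star (x - y) = star x - star y.
Proof. by rewrite starD starN. Qed.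

Lemma starZr r x : star (cR r *: x) = cR r *: star x.
Proof. by rewrite starZ cR_conj. Qed.

Lemma star_sum I (s : seq I) (P : pred I) (F : I -> B) :
  star (\sum_(i <- s | P i) F i) = \sum_(i <- s | P i) star (F i).
Proof. exact: (big_morph _ (@starD R B) (star0 B)). Qed.

Lemma halvesD x : cR 2^-1 *: x + cR 2^-1 *: x = x.
Proof.
by rewrite -scalerDl -cRD (_ : 2^-1 + 2^-1 = 1) ?cR1 ?scale1r//; field.
Qed.

Definition rcst (r : R) : B := cR r *: (1 : B).

Lemma rcst1 : rcst 1 = 1.
Proof. by rewrite /rcst cR1 scale1r. Qed.

Lemma rcstD r s : rcst (r + s) = rcst r + rcst s.
Proof. by rewrite /rcst cRD scalerDl. Qed.

Lemma rcstN r : rcst (- r) = - rcst r.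
Proof. by rewrite /rcst cRN scaleNr. Qed.

Lemma rcstB r s : rcst (r - s) = rcst r - rcst s.
Proof. by rewrite /rcst cRB scalerBl. Qed.

Lemma rcstZ r s : cR r *: rcst s = rcst (r * s).
Proof. by rewrite /rcst scalerA cRM. Qed.

Lemma rcst_mull r x : rcst r * x = cR r *: x.
Proof. by rewrite starAl mul1r. Qed.

Lemma rcst_mulr r x : x * rcst r = cR r *: x.
Proof. by rewrite starAr mulr1. Qed.

Lemma star_rcst r : star (rcst r) = rcst r.
Proof. by rewrite starZr star1. Qed.

Lemma scaler_divK r x : r != 0 -> cR r *: (cR r^-1 *: x) = x.
Proof. by move=> r0; rewrite scalerA -cRM mulfV// cR1 scale1r. Qed.

Lemma comm_rcst x r : GRing.comm x (rcst r).
Proof. by rewrite /GRing.comm rcst_mull rcst_mulr. Qed.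

Lemma commrZ (a : cplx R) x y : GRing.comm x y -> GRing.comm x (a *: y).
Proof. by rewrite /GRing.comm starAl starAr => ->. Qed.

End RealScaling.
Arguments rcst {R} B r.

(* bd r x stands for "the norm of x is at most r". *)
Record complete_bound (R : realType) (B : starAlgType R) (bd : R -> B -> Prop) : Prop := {
  bd_ge0 : forall r x, bd r x -> 0 <= r;
  bd_le : forall r s x, r <= s -> bd r x -> bd s x;
  bd_ex : forall x, exists r, bd r x;
  bd_add : forall r s x y, bd r x -> bd s y -> bd (r + s) (x + y);
  bd_mul : forall r s x y, bd r x -> bd s y -> bd (r * s) (x * y);
  bd_scale : forall (a : R) r x, bd r x -> bd (`|a| * r) (cR a *: x);
  bd_star : forall r x, bd r x -> bd r (star x);
  bd_sep : forall x, bd 0 x -> x = 0;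
  bd_closed : forall r x, (forall e, 0 < e -> bd (r + e) x) -> bd r x;
  bd_cauchy : forall u : nat -> B,
    (forall e, 0 < e -> exists N, forall n, (N <= n)%N -> bd e (u n - u N)) ->
    exists l, forall e, 0 < e -> exists N, forall n, (N <= n)%N -> bd e (u n - l)
}.

Section BoundedLimits.
Variables (R : realType) (B : starAlgType R) (bd : R -> B -> Prop).
Hypothesis H : complete_bound bd.
Implicit Types (u v : nat -> B) (x y z : B).

Definition blim u x :=
  forall e, 0 < e -> exists N, forall n, (N <= n)%N -> bd e (u n - x).

Lemma bd0 r : 0 <= r -> bd r 0.
Proof.
move=> r0; apply: (bd_le H) r0 _.
have [s] := bd_ex H 0.
by move/(bd_scale H 0); rewrite normr0 mul0r cR0 scale0r.
Qed.

Lemma bdN r x : bd r x -> bd r (- x).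
Proof.
by move/(bd_scale H (-1)); rewrite normrN1 mul1r cRN cR1 scaleN1r.
Qed.

Lemma bdB r s x y : bd r x -> bd s y -> bd (r + s) (x - y).
Proof. by move=> rx /bdN; exact: (bd_add H). Qed.

Lemma bd_scale_ge0 a r x : 0 <= a -> bd r x -> bd (a * r) (cR a *: x).
Proof. by move=> a0 /(bd_scale H a); rewrite ger0_norm. Qed.

Lemma bd_eq0 x : (forall e, 0 < e -> bd e x) -> x = 0.
Proof. by move=> h; apply: (bd_sep H); apply: (bd_closed H) => e e0; rewrite add0r; exact: h. Qed.

Lemma blim_uniq u x y : blim u x -> blim u y -> x = y.
Proof.
move=> ux uy; apply/eqP; rewrite -subr_eq0; apply/eqP/bd_eq0 => e e0.
have e2 : 0 < e / 2 by lra.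
have [N hN] := ux _ e2; have [M hM] := uy _ e2.
have h1 := hM _ (leq_maxr N M); have h2 := hN _ (leq_maxl N M).
have := bdB h1 h2; rewrite (_ : e / 2 + e / 2 = e); last by field.
by rewrite opprB addrC addrA subrK.
Qed.

Lemma blim_cst x : blim (fun=> x) x.
Proof. by move=> e e0; exists 0 => n _; rewrite subrr; apply: bd0; exact: ltW. Qed.

Lemma blimD u v x y : blim u x -> blim v y -> blim (fun n => u n + v n) (x + y).
Proof.
move=> ux vy e e0; have e2 : 0 < e / 2 by lra.
have [N hN] := ux _ e2; have [M hM] := vy _ e2.
exists (maxn N M) => n; rewrite geq_max => /andP[/hN h1 /hM h2].
have := bd_add H h1 h2; rewrite (_ : e / 2 + e / 2 = e); last by field.
by rewrite opprD addrACA.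
Qed.

Lemma blimM u v x y : blim u x -> blim v y -> blim (fun n => u n * v n) (x * y).
Proof.
move=> ux vy e e0.
have [r rx] := bd_ex H x; have [s sy] := bd_ex H y.
have r0 := bd_ge0 H rx; have s0 := bd_ge0 H sy.
(* With d <= 1 the error d d + d s + r d is at most d (1 + r + s) <= e. *)
pose d := Num.min 1 (e / (1 + r + s)).
have k0 : 0 < 1 + r + s by lra.
have d0 : 0 < d by rewrite lt_min ltr01 divr_gt0.
have d1 : d <= 1 by rewrite ge_min lexx.
have de : d * (1 + r + s) <= e by rewrite -ler_pdivlMr// ge_min lexx orbT.
have [N hN] := ux _ d0; have [M hM] := vy _ d0.
exists (maxn N M) => n; rewrite geq_max => /andP[/hN h1 /hM h2].
apply: (@bd_le _ _ _ H (d * d + d * s + r * d)).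
  apply: le_trans de; rewrite !mulrDr mulr1 [r * d]mulrC addrAC.
  by rewrite !lerD2r -[leRHS]mulr1 ler_wpM2l// ltW.
have -> : u n * v n - x * y = (u n - x) * (v n - y) + (u n - x) * y + x * (v n - y).
  by rewrite -mulrDr subrK mulrBl mulrBr addrA subrK.
by apply: (bd_add H); [apply: (bd_add H)|]; apply: (bd_mul H).
Qed.

Lemma blimZ r u x : blim u x -> blim (fun n => cR r *: u n) (cR r *: x).
Proof.
move=> ux e e0; have r0 : 0 < `|r| + 1 by rewrite ltr_wpDl.
have [N hN] := ux (e / (`|r| + 1)) (divr_gt0 e0 r0).
exists N => n /hN /(bd_scale H r); rewrite scalerBr; apply: (bd_le H).
rewrite mulrCA -[leRHS]mulr1 ler_wpM2l ?(ltW e0)//.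
by rewrite ler_pdivrMr// mul1r lerDl.
Qed.

Lemma blim_star u x : blim u x -> blim (fun n => star (u n)) (star x).
Proof.
move=> ux e e0; have [N hN] := ux e e0.
by exists N => n /hN; rewrite -starB; exact: (bd_star H).
Qed.

Lemma blimS u x : blim u x -> blim (fun n => u n.+1) x.
Proof. by move=> ux e e0; have [N hN] := ux e e0; exists N => n Nn; apply: hN; exact: leqW. Qed.

Lemma blim_eq u v x : u =1 v -> blim u x -> blim v x.
Proof. by move=> /funext ->. Qed.

Lemma blim_comm u x y : (forall n, GRing.comm y (u n)) -> blim u x -> GRing.comm y x.
Proof.
move=> yu ux; apply: (@blim_uniq (fun n => y * u n)).
  by apply: blimM => //; exact: blim_cst.
apply: (@blim_eq (fun n => u n * y)) => [n|]; first by rewrite yu.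
by apply: blimM => //; exact: blim_cst.
Qed.

Lemma blim_bd u x r : (forall n, bd r (u n)) -> blim u x -> bd r x.
Proof.
move=> ur ux; apply: (bd_closed H) => e e0; have [N hN] := ux e e0.
have := bdB (ur N) (hN N (leqnn N)).
by rewrite opprB [u N + _]addrC subrK.
Qed.

(** Increments telescope: once [c N] is within e of the supremum of [c], the later terms of [u] stay
    within e of [u N]. *)
Lemma blim_majorized u (c : nat -> R) M : (forall n, c n <= M) ->
  (forall n, bd (c n.+1 - c n) (u n.+1 - u n)) -> exists x, blim u x.
Proof.
move=> cM uc; apply: (bd_cauchy H) => e e0.
have uck n k : bd (c (n + k)%N - c n) (u (n + k)%N - u n).
  elim: k => [|k ih]; first by rewrite addn0 !subrr; exact: bd0.
  rewrite addnS; have := bd_add H (uc (n + k)%N) ih.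
  by rewrite !addrA !subrK.
have cs : has_sup (range c).
  by split; [exists (c 0), 0|exists M => _ [n _ <-]].
have [_ [N _ <-] cN] := sup_adherent e0 cs.
exists N => n Nn; rewrite -(subnKC Nn); apply: (bd_le H) (uck _ _).
have : c (N + (n - N))%N <= sup (range c) by apply: ub_le_sup; [exact: cs.2|exists (N + (n - N))%N].
by lra.
Qed.

(* The iteration z' = (y + z^2)/2 is dominated term by term by the scalar one
   c' = (1 + c^2)/2, which is increasing and bounded by 1. *)
Lemma sqrt_one_sub y : bd 1 y -> star y = y ->
  exists z, [/\ star z = z, bd 1 z, (1 - z) * (1 - z) = 1 - y &
    forall w, GRing.comm w y -> GRing.comm w z].
Proof.
move=> y1 ys.
pose z n := iter n (fun z => cR 2^-1 *: (y + z * z)) 0.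
pose c n := iter n (fun c : R => 2^-1 * (1 + c * c)) 0.
have zS n : z n.+1 = cR 2^-1 *: (y + z n * z n) by [].
have cS n : c n.+1 = 2^-1 * (1 + c n * c n) by [].
have h0 : 0 <= 2^-1 :> R by rewrite invr_ge0 ler0n.
have c01 n : 0 <= c n <= 1.
  elim: n => [|n /andP[c0 c1]]; first by rewrite /c /= lexx ler01.
  by rewrite cS; nra.
have zc n : bd (c n) (z n).
  elim: n => [|n ih]; first exact: bd0.
  by rewrite cS zS; apply: bd_scale_ge0 => //; apply: (bd_add H) => //; exact: (bd_mul H).
have zcomm w n : GRing.comm w y -> GRing.comm w (z n).
  move=> wy; elim: n => [|n ih]; first exact: commr0.
  by rewrite zS; apply: commrZ; apply: commrD => //; exact: commrM.
(* Commutation of consecutive iterates lets the difference of squares factor below. *)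
have zz n : z n * z n.+1 = z n.+1 * z n.
  by apply: (zcomm); apply: commr_sym; exact: zcomm.
have zd n : bd (c n.+1 - c n) (z n.+1 - z n).
  elim: n => [|n ih].
    rewrite cS zS /c /z /= !mulr0 !subr0 !addr0.
    exact: bd_scale_ge0.
  have -> : c n.+2 - c n.+1 = 2^-1 * ((c n.+1 - c n) * (c n.+1 + c n)).
    by have := cS n; rewrite (cS n.+1); lra.
  have -> : z n.+2 - z n.+1 = cR 2^-1 *: ((z n.+1 - z n) * (z n.+1 + z n)).
    rewrite zS [in X in _ - X]zS -scalerBr; congr (_ *: _).
    by rewrite mulrDr !mulrBl zz opprD addrACA subrr add0r addrA subrK.
  by apply: bd_scale_ge0 => //; apply: (bd_mul H) => //; exact: (bd_add H).
have [|x zx] := @blim_majorized z c 1 _ zd; first by move=> n; case/andP: (c01 n).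
have xE : x = cR 2^-1 *: (y + x * x).
  apply: (blim_uniq (blimS zx)); apply: (@blim_eq (fun n => cR 2^-1 *: (y + z n * z n))) => //.
  by apply: blimZ; apply: blimD; [exact: blim_cst|exact: blimM].
have zs n : star (z n) = z n.
  elim: n => [|n ih]; first exact: star0.
  by rewrite zS starZr starD ys starM ih.
exists x; split.
- apply: (@blim_uniq z) => //.
  by apply: blim_eq (blim_star zx) => n; rewrite zs.
- apply: (blim_bd _ zx) => n; apply: (bd_le H) (zc n).
  by case/andP: (c01 n).
(* The fixed point equation x = (y + x^2)/2 says exactly that (1 - x)^2 = 1 - y. *)
- have x2 : x + x = y + x * x by rewrite {1 2}xE halvesD.
  rewrite mulrBl mul1r mulrBr mulr1. 
  apply: (addIr (x + x)); rewrite {2}x2; ncring.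
- by move=> w wy; apply: blim_comm zx => n; exact: zcomm.
Qed.

(** The partial sums of the geometric series are iterates of z' = 1 + x z, majorized by c' = b + q
    c, whose fixed point is b / (1 - q). Here b bounds the unit, which need not have bound 1. *)
Lemma neumann q x : bd q x -> q < 1 -> exists v : B, v * (1 - x) = 1 /\ (1 - x) * v = 1.
Proof.
move=> xq q1; have q0 := bd_ge0 H xq.
have [b b1] := bd_ex H 1; have b0 := bd_ge0 H b1.
pose z n := iter n (fun z => 1 + x * z) 0.
pose c n := iter n (fun c : R => b + q * c) 0.
have zS n : z n.+1 = 1 + x * z n by [].
have cS n : c n.+1 = b + q * c n by [].
have cM n : c n <= b / (1 - q).
  elim: n => [|n ih]; first by apply: divr_ge0 => //; lra.
  rewrite cS (_ : b / (1 - q) = b + q * (b / (1 - q))); last by field; lra.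
  by rewrite lerD2l ler_wpM2l.
have zd n : bd (c n.+1 - c n) (z n.+1 - z n).
  elim: n => [|n ih]; first by rewrite /c /z /= !mulr0 !subr0 !addr0.
  have -> : c n.+2 - c n.+1 = q * (c n.+1 - c n) by rewrite !cS; ring.
  have -> : z n.+2 - z n.+1 = x * (z n.+1 - z n).
    by rewrite mulrBr zS [in X in _ - X]zS opprD addrACA subrr add0r.
  exact: (bd_mul H).
have [v zv] := blim_majorized cM zd.
have vE : v = 1 + x * v.
  apply: (blim_uniq (blimS zv)); apply: (@blim_eq (fun n => 1 + x * z n)) => //.
  by apply: blimD; [exact: blim_cst|apply: blimM => //; exact: blim_cst].
have vx : GRing.comm x v.
  apply: blim_comm zv; elim=> [|n ih]; first exact: commr0.
  by rewrite zS; apply: commrD; [exact: commr1|exact: commrM].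
have v1 : v - x * v = 1 by rewrite {1}vE addrK.
by exists v; rewrite mulrBr mulrBl mulr1 mul1r -vx v1.
Qed.

End BoundedLimits.

(** * Positive elements of a C*-algebra *)

Section CStarOrder.
Variables (R : realType) (A : cstarAlgType R).
Implicit Types (x y a b d p : A) (r e : R).

Definition nrm (x : A) : R := complex.Re `|x|.

Lemma nrmE x : `|x| = cR (nrm x).
Proof.
have := normr_ge0 x; rewrite /nrm; case: `|x| => u v.
by rewrite lecE /= => /andP[/eqP -> _].
Qed.

Lemma nrm_ge0 x : 0 <= nrm x.
Proof. by rewrite -cR_ge0 -nrmE normr_ge0. Qed.

Lemma nrmD x y : nrm (x + y) <= nrm x + nrm y.
Proof. by rewrite -cR_le cRD -!nrmE ler_normD. Qed.

Lemma nrmM x y : nrm (x * y) <= nrm x * nrm y.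
Proof. by rewrite -cR_le cRM -!nrmE; exact: cstar_normM. Qed.

Lemma nrm_sqr x : nrm (star x * x) = nrm x ^+ 2.
Proof. by apply: (@cR_inj R); rewrite cRX -!nrmE; exact: cstar_norm. Qed.

Lemma nrmZ r x : nrm (cR r *: x) = `|r| * nrm x.
Proof. by apply: (@cR_inj R); rewrite cRM -!nrmE normrZ cR_norm. Qed.

Lemma nrm0 : nrm 0 = 0.
Proof. by rewrite /nrm normr0. Qed.

Lemma nrmN x : nrm (- x) = nrm x.
Proof. by rewrite /nrm normrN. Qed.

Lemma nrm_eq0 x : nrm x = 0 -> x = 0.
Proof. by move=> x0; apply/normr0_eq0; rewrite nrmE x0. Qed.

Lemma nrm_star x : nrm (star x) = nrm x.
Proof.
suff le y : nrm y <= nrm (star y) by apply/le_anti; rewrite le andbT -{2}[x]starK le.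
have := nrm_ge0 y; rewrite le_eqVlt => /orP[/eqP <-|y0]; first exact: nrm_ge0.
by rewrite -(ler_pM2r y0) -expr2 -nrm_sqr nrmM.
Qed.

(** Only an inequality, since the algebra may be zero. *)
Lemma nrm1 : nrm (1 : A) <= 1.
Proof.
have := nrm_sqr 1; rewrite star1 mulr1 => h.
have := nrm_ge0 1; rewrite le_eqVlt => /orP[/eqP <-|n0]; first exact: ler01.
by rewrite -(ler_pM2r n0) mul1r -expr2 -h.
Qed.

Lemma nrm_rcst r : nrm (rcst A r) <= `|r|.
Proof. by rewrite nrmZ -[leRHS]mulr1 ler_wpM2l ?nrm1. Qed.

Lemma nrm_bound : complete_bound (fun r x => nrm x <= r).
Proof.
split.
- by move=> r x; apply: le_trans; exact: nrm_ge0.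
- by move=> r s x rs xr; exact: le_trans rs.
- by move=> x; exists (nrm x).
- by move=> r s x y xr ys; apply: le_trans (nrmD _ _) _; exact: lerD.
- by move=> r s x y xr ys; apply: le_trans (nrmM _ _) _; apply: ler_pM => //; exact: nrm_ge0.
- by move=> a r x xr; rewrite nrmZ ler_wpM2l.
- by move=> r x; rewrite nrm_star.
- by move=> x x0; apply: nrm_eq0; apply/le_anti; rewrite x0 nrm_ge0.
- move=> r x h; apply/ler_addgt0Pr => e e0; exact: h.
- move=> u hu.
  have [l ul] : exists l : A, u @ \oo --> l.
    suff : cvg (u @ \oo) by move=> /cvg_ex.
    apply/cauchy_cvgP/cauchy_exP => e e0.
    have e1 : 0 < complex.Re e by move: e0; rewrite ltcE => /andP[].
    have eE : e = cR (complex.Re e).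
      by move: e0; case: e {e1} => er ei; rewrite ltcE /= => /andP[/eqP ->].
    have e2 : 0 < complex.Re e / 2 by lra.
    have [N hN] := hu _ e2.
    exists (u N); exists N => // m /= /hN h.
    rewrite -ball_normE /ball_/= distrC eE nrmE.
    by rewrite -(subr_gt0 (cR _)) -cRB /cR ltcR subr_gt0; lra.
  exists l => e e0; have ce : 0 < cR e by rewrite /cR ltcR.
  have /cvgrPdist_lt/(_ _ ce)[N _ hN] := ul.
  exists N => n Nn; rewrite -nrmN opprB -cR_le -nrmE; apply: ltW; exact: hN.
Qed.

(* This description of the positive elements is the one that is visibly stable under
   sums.  The r is automatically nonnegative. *)
Definition cpos (x : A) := star x = x /\ exists r, nrm (rcst A r - x) <= r.

Lemma cposD x y : cpos x -> cpos y -> cpos (x + y).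
Proof.
move=> [xs [r xr]] [ys [s yss]]; split; first by rewrite starD xs ys.
exists (r + s); rewrite rcstD opprD addrACA.
by apply: le_trans (nrmD _ _) _; exact: lerD.
Qed.

Lemma cposZ r x : 0 <= r -> cpos x -> cpos (cR r *: x).
Proof.
move=> r0 [xs [s xr]]; split; first by rewrite starZr xs.
exists (r * s); rewrite -rcstZ -scalerBr nrmZ ger0_norm//.
exact: ler_wpM2l.
Qed.

Lemma cpos_sub r x : star x = x -> nrm x <= r -> cpos (rcst A r - x).
Proof.
move=> xs xr; split; first by rewrite starB star_rcst xs.
by exists r; rewrite opprB addrCA subrr addr0.
Qed.

Lemma cpos_rcst r : 0 <= r -> cpos (rcst A r).
Proof.
by move=> r0; split; [exact: star_rcst|exists r; rewrite subrr nrm0].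
Qed.

(** After scaling, 1 - x/r lies in the unit ball, so [sqrt_one_sub] yields z with (1 - z)^2 = x/r.
    The radius is first enlarged by 1 to make r nonzero. *)
Lemma cpos_sqrt x : cpos x -> exists b, [/\ star b = b, cpos b, b * b = x &
  forall w, GRing.comm w x -> GRing.comm w b].
Proof.
move=> [xs [r0 xr0]].
have [r r_gt0 xr] : exists2 r, 0 < r & nrm (rcst A r - x) <= r.
  exists (r0 + 1); first by rewrite ltr_wpDl// (le_trans _ xr0)// nrm_ge0.
  rewrite rcstD rcst1 addrAC.
  by apply: le_trans (nrmD _ _) _; rewrite lerD// nrm1.
pose y := 1 - cR r^-1 *: x.
have rr : cR r^-1 *: rcst A r = 1.
  by rewrite scalerA -cRM mulVf ?gt_eqF// cR1 scale1r.
have y1 : nrm y <= 1.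
  rewrite /y -rr -scalerBr nrmZ gtr0_norm ?invr_gt0//.
  by rewrite ler_pdivrMl// mulr1.
have ys : star y = y by rewrite /y starB star1 starZr xs.
have [z [zs z1 zz zw]] := sqrt_one_sub nrm_bound y1 ys.
have sr : 0 <= Num.sqrt r by exact: sqrtr_ge0.
have bs : star (cR (Num.sqrt r) *: (1 - z)) = cR (Num.sqrt r) *: (1 - z).
  by rewrite starZr starB star1 zs.
exists (cR (Num.sqrt r) *: (1 - z)); split => //.
- split=> //; exists (Num.sqrt r).
  by rewrite scalerBr opprB addrCA subrr addr0 nrmZ ger0_norm// -[leRHS]mulr1 ler_wpM2l.
- rewrite starAl starAr scalerA -cRM -expr2 sqr_sqrtr ?ltW// zz /y.
  by rewrite opprB addrCA subrr addr0 scaler_divK ?gt_eqF.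
- move=> w wx; apply: commrZ; apply: commrB; first exact: commr1.
  by apply: zw; apply: commrB; [exact: commr1|exact: commrZ].
Qed.

(* b + i d is a multiple of a unitary. *)
Lemma nrm_sqr_le b d r : 0 <= r -> star b = b -> star d = d -> GRing.comm b d ->
  b * b + d * d = rcst A r -> nrm b ^+ 2 <= r.
Proof.
move=> r0 bs ds bd bdr; pose u := b + 'i *: d.
have us : star u = b - 'i *: d by rewrite /u starD starZ conjCi bs ds scaleNr.
have ur : nrm u ^+ 2 <= r.
  rewrite -nrm_sqr us.
  have -> : (b - 'i *: d) * u = rcst A r.
    rewrite /u mulrDr !mulrBl !starAl !starAr !scalerA -bdr bd.
    by rewrite mulii scaleN1r; ncring.
  by apply: le_trans (nrm_rcst _) _; rewrite ger0_norm.
have bu : b = cR 2^-1 *: (u + star u).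
  by rewrite us /u addrACA subrr addr0 scalerDr halvesD.
apply: le_trans ur; rewrite lerXn2r ?nnegrE ?nrm_ge0//.
rewrite bu nrmZ ger0_norm ?invr_ge0// ler_pdivrMl//.
by apply: le_trans (nrmD _ _) _; rewrite nrm_star; lra.
Qed.

(** The square roots b of p and d of r - p commute and satisfy b^2 + d^2 = r. *)
Lemma nrm_le p r : 0 <= r -> cpos p -> cpos (rcst A r - p) -> nrm p <= r.
Proof.
move=> r0 /cpos_sqrt[b [bs _ bp bw]] /cpos_sqrt[d [ds _ dp dw]].
rewrite -bp -{1}bs nrm_sqr; apply: (nrm_sqr_le (d := d)) => //; last first.
  by rewrite bp dp addrC subrK.
apply: dw; apply: commrB; first exact: comm_rcst.
by apply: commr_sym; apply: bw; apply: commr_refl.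
Qed.

(** With r the norm of b^2 and d a square root of r - b^2, one has d^2 + b^2 = r, so r - b^2 = d^2
    has norm at most r. *)
Lemma cpos_sqr b : star b = b -> cpos (b * b).
Proof.
move=> bs; have bbs : star (b * b) = b * b by rewrite starM bs.
split=> //; exists (nrm (b * b)); set r := nrm _.
have [d [ds _ dp dw]] := cpos_sqrt (cpos_sub bbs (lexx _)).
rewrite /r -dp -{1}ds nrm_sqr; apply: (nrm_sqr_le (d := b)) => //; first exact: nrm_ge0.
  apply: commr_sym; apply: dw; apply: commrB; first exact: comm_rcst.
  exact: commrM (commr_refl _) (commr_refl _).
by rewrite dp subrK.
Qed.

(** e + x = (r + e)(1 - c) where c has norm at most r / (r + e) < 1. *)
Lemma cpos_inv x e : cpos x -> 0 < e ->
  exists v : A, v * (rcst A e + x) = 1 /\ (rcst A e + x) * v = 1.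
Proof.
move=> [xs [r xr]] e0; have r0 : 0 <= r by exact: le_trans (nrm_ge0 _) xr.
have re : 0 < r + e by lra.
pose c := cR (r + e)^-1 *: (rcst A r - x).
have c1 : nrm c <= r / (r + e).
  by rewrite nrmZ gtr0_norm ?invr_gt0// mulrC ler_pM2r ?invr_gt0.
have q1 : r / (r + e) < 1 by rewrite ltr_pdivrMr// mul1r; lra.
have [v [v1 v2]] := neumann nrm_bound c1 q1.
have xE : rcst A e + x = cR (r + e) *: (1 - c).
  by rewrite scalerBr scaler_divK ?gt_eqF// -/(rcst A _) rcstD; ncring.
exists (cR (r + e)^-1 *: v); rewrite xE !starAl !starAr v1 v2.
by rewrite scaler_divK ?gt_eqF// scalerA -cRM mulVf ?gt_eqF// cR1 scale1r.
Qed.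

Lemma comm_inv (v x w : A) : v * x = 1 -> x * v = 1 -> GRing.comm w x -> GRing.comm w v.
Proof.
move=> vx xv wx; rewrite /GRing.comm -[w * v]mul1r -vx -mulrA (mulrA x) -wx.
by rewrite -!mulrA xv mulr1.
Qed.

Lemma star_inv (v x : A) : star x = x -> v * x = 1 -> x * v = 1 -> star v = v.
Proof.
move=> xs vx xv; have := congr1 star xv; rewrite starM xs star1 => sx.
by rewrite -[star v]mulr1 -xv mulrA sx mul1r.
Qed.

(** The norm r of a positive p is a spectral value: if r > 0 and r - p had an inverse v <= M, then r
    - p >= 1/M, so p would have norm at most r - 1/M. *)
Lemma cpos_eq0 p : cpos p -> (forall e, 0 < e -> exists v : A,
  v * (rcst A e - p) = 1 /\ (rcst A e - p) * v = 1) -> p = 0.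
Proof.
move=> pp pinv; apply: nrm_eq0; apply/eqP; rewrite eq_le nrm_ge0 andbT leNgt.
apply/negP => r0; set r := nrm p in r0.
have [d [ds _ dE dw]] := cpos_sqrt (cpos_sub pp.1 (lexx (nrm p))).
have [v [v1 v2]] := pinv _ r0; rewrite -/r in dE dw; rewrite -dE in v1 v2.
have dds : star (d * d) = d * d by rewrite starM ds.
have vs := star_inv dds v1 v2.
have dv : GRing.comm d v by apply: comm_inv v1 v2 _; exact: commrM.
(* Adding 1/r ensures M > 0 and 1/M <= r. *)
pose M := nrm v + r^-1.
have vM : nrm v <= M by rewrite lerDl invr_ge0 ltW.
have [e [es _ eE ew]] := cpos_sqrt (cpos_sub vs vM).
have de : GRing.comm d e.
  by apply: ew; apply: commrB => //; exact: comm_rcst.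
have M0 : 0 < M by rewrite ltr_wpDl ?nrm_ge0 ?invr_gt0.
have pM : cpos (rcst A (r - M^-1) - p).
  (* With d^2 = r - p and e^2 = M - v, the square (e d)^2 = (M - v) d^2 equals M d^2 - 1. *)
  have -> : rcst A (r - M^-1) - p = cR M^-1 *: ((e * d) * (e * d)).
    have -> : e * d * (e * d) = rcst A M * (d * d) - 1.
      have -> : e * d * (e * d) = e * e * (d * d) by rewrite -!mulrA (mulrA d) de -!mulrA.
      by rewrite eE mulrBl v1.
    rewrite dE rcst_mull scalerBr scalerA -cRM mulVf ?gt_eqF// cR1 scale1r.
    by rewrite rcstB -/(rcst A _); ncring.
  apply: cposZ; first by rewrite invr_ge0 ltW.
  by apply: cpos_sqr; rewrite starM es ds.
have rM : 0 <= r - M^-1.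
  rewrite subr_ge0 -[leRHS]invrK lef_pV2 ?posrE ?invr_gt0// lerDr.
  exact: nrm_ge0.
have Mi : 0 < M^-1 by rewrite invr_gt0.
by have := nrm_le rM pp pM; rewrite -/r; lra.
Qed.

(* Kaplansky's argument.  With b = |x| for x = a^* a and y = b - x, the element
   c = a y has c^* c = - y b y, whose negative p is positive; then c c^* is
   positive too, and c^* c, c c^* have the same nonzero spectrum, so p = 0. *)
Lemma cpos_mulstar (a : A) : cpos (star a * a).
Proof.
set x := star a * a.
have xs : star x = x by rewrite /x starM starK.
have [b [bs bp bE bw]] := cpos_sqrt (cpos_sqr xs).
have xb : GRing.comm x b by apply: bw; exact: commrM.
have [h [hs _ hE hw]] := cpos_sqrt bp.
pose y := b - x.
have ys : star y = y by rewrite /y starB bs xs.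
have yb : GRing.comm y b.
  by apply: commr_sym; apply: commrB => //; exact: commr_sym.
have yh : GRing.comm y h by exact: hw.
have yx : y * (x + b) = 0.
  by rewrite /y mulrBl !mulrDr bE xb; ncring.
pose p := (h * y) * (h * y).
have hys : star (h * y) = h * y by rewrite starM hs ys.
have pE : p = y * b * y.
  by rewrite /p -{1}yh -mulrA (mulrA h) hE mulrA.
have pp : cpos p by exact: cpos_sqr.
pose c := a * y.
have cc : star c * c = - p.
  rewrite /c starM ys -mulrA (mulrA (star a)) -/x.
  apply/eqP; rewrite -addr_eq0 pE -mulrA -mulrDr -mulrDl mulrA.
  by rewrite -[y * (x + b)]/(y * (x + b)) yx mul0r.
have ccp : cpos (c * star c).
  pose u := c + star c; pose v := 'i *: (c - star c).
  have us : star u = u by rewrite /u starD starK addrC.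
  have vs : star v = v by rewrite /v starZ conjCi starB starK scaleNr -scalerN opprB.
  (* u and v are twice the real part and, up to sign, twice the imaginary part of c, so
     [c * star c + star c * c] is half of u^2 + v^2. *)
  have -> : c * star c = cR 2^-1 *: (u * u + v * v) + p.
    rewrite /v starAl starAr scalerA mulii scaleN1r.
    have -> : u * u - (c - star c) * (c - star c) =
       (c * star c - p) + (c * star c - p) by rewrite -cc /u; ncring.
    by rewrite scalerDr halvesD subrK.
  apply: cposD => //; apply: cposZ; first by rewrite invr_ge0.
  by apply: cposD; exact: cpos_sqr.
have p0 : p = 0.
  apply: cpos_eq0 => // e e0.
  have [w [w1 w2]] := cpos_inv ccp e0.
  have ewc1 : w * (c * star c) = 1 - cR e *: w.
    by rewrite -w1 mulrDr rcst_mulr; ncring.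
  have ewc2 : c * star c * w = 1 - cR e *: w.
    by rewrite -w2 mulrDl rcst_mull; ncring.
  have ee : e != 0 by rewrite gt_eqF.
  have -> : rcst A e - p = rcst A e + star c * c by rewrite cc.
  (* The standard formula carrying an inverse w of [e + c * star c] to one of [e + star c * c]. *)
  exists (cR e^-1 *: (1 - star c * w * c)); split.
    rewrite starAl mulrDr rcst_mulr -[RHS](scaler_divK _ ee) scalerA mulrC -scalerA; congr (_ *: _).
    rewrite mulrBl mul1r.
    have -> : star c * w * c * (star c * c) = star c * (w * (c * star c)) * c by rewrite !mulrA.
    by rewrite ewc1 mulrBr mulr1 starAr mulrBl starAl scalerBr; ncring.
  rewrite starAr mulrDl rcst_mull -[RHS](scaler_divK _ ee) scalerA mulrC -scalerA; congr (_ *: _).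
  rewrite mulrBr mulr1.
  have -> : star c * c * (star c * w * c) = star c * (c * star c * w) * c by rewrite !mulrA.
  by rewrite ewc2 mulrBr mulr1 starAr mulrBl starAl scalerBr; ncring.
have sq0 (z : A) : star z = z -> z * z = 0 -> z = 0.
  move=> zs zz; apply: nrm_eq0; apply/eqP.
  by rewrite -sqrf_eq0 -nrm_sqr zs zz nrm0.
have hy0 : h * y = 0 by exact: (sq0 _ hys).
have by0 : b * y = 0 by rewrite -hE -mulrA hy0 mulr0.
have yx0 : y * x = 0 by move: yx; rewrite mulrDr yb by0 addr0.
have yy0 : y = 0.
  by apply: (sq0) => //; rewrite {2}/y mulrBr yx0 subr0 yb.
by rewrite (_ : x = b) //; apply/eqP; rewrite eq_sym -subr_eq0 -/y yy0.
Qed.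

End CStarOrder.

(** * Positive functionals *)

Section ConeFunctional.
Variables (R : realType) (B : starAlgType R) (P : set B).
Hypotheses (P_add : forall x y, P x -> P y -> P (x + y))
  (P_scale : forall r x, 0 <= r -> P x -> P (cR r *: x))
  (P_unit : forall x, exists r, P (rcst B r - x))
  (P_one : P 1) (P_proper : ~ P (- 1)).
Implicit Types (x y : B) (r s : R).

Let cone (X : set B) := [/\ forall x y, X x -> X y -> X (x + y),
  forall r x, 0 <= r -> X x -> X (cR r *: x), ~ X (- 1) &
  forall x, X x -> P `<=` X].

Let maximal_cone : exists2 M, cone M & P `<=` M /\
  forall x, ~ M x -> exists r y, [/\ 0 <= r, M y & - 1 = y + cR r *: x].
Proof.
have [F FC Ftot|M [[MD MZ M1 MP] Mmax]] := @Zorn_bigcup B cone.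
  split.
  - move=> x y [X FX Xx] [Y FY Yy].
    have [XY|YX] := Ftot _ _ FX FY.
      by exists Y => //; have [YD _ _ _] := FC _ FY; apply: YD => //; exact: XY.
    by exists X => //; have [XD _ _ _] := FC _ FX; apply: XD => //; exact: YX.
  - by move=> r x r0 [X FX Xx]; exists X => //; have [_ XZ _ _] := FC _ FX; exact: XZ.
  - by move=> [X FX X1]; have [_ _ h _] := FC _ FX; exact: h.
  - move=> x [X FX Xx] y Py; exists X => //.
    by have [_ _ _ h] := FC _ FX; exact: (h x).
have PM : P `<=` M.
  have [[x Mx]|M0] := pselect (exists x, M x); first exact: (MP x).
  have PC : cone P by rewrite /cone; split=> // x _ y.
  exfalso; apply: (Mmax P) PC; split; first by move=> x Mx; exfalso; apply: M0; exists x.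
  by move=> PM; apply: M0; exists 1; exact: PM.
exists M; split=> // x Mx.
have M0 : M 0 by have := MZ 0 1 (lexx 0) (PM _ P_one); rewrite cR0 scale0r.
apply: contrapT => nr; pose N : set B := [set z | exists r y, [/\ 0 <= r, M y & z = y + cR r *: x]].
have MN : M `<=` N by move=> y My; exists 0, y; rewrite cR0 scale0r addr0.
apply: (Mmax N).
  split=> // NM; apply: Mx; apply: NM; exists 1, 0; split=> //.
  by rewrite add0r cR1 scale1r.
split.
- move=> _ _ [r [y [r0 My ->]]] [s [z [s0 Mz ->]]].
  exists (r + s), (y + z); split; [exact: addr_ge0|exact: MD|].
  by rewrite addrACA -scalerDl cRD.
- move=> r _ r0 [s [z [s0 Mz ->]]].
  exists (r * s), (cR r *: z); split; [exact: mulr_ge0|exact: MZ|].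
  by rewrite scalerDr scalerA cRM.
- by move=> [r [y h]]; apply: nr; exists r, y.
- by move=> _ _; exact: (subset_trans PM).
Qed.

(** A maximal cone M orders B totally, and [f x] is the cut made by x in the real scalars. The
    functional is only real-linear. *)
Lemma cone_functional : exists f : B -> R,
  [/\ forall x y, f (x + y) = f x + f y, forall r x, f (cR r *: x) = r * f x,
      f 1 = 1 & forall x, P x -> 0 <= f x].
Proof.
have [M [MD MZ M1 _] [PM Mmax]] := maximal_cone.
(* If neither x nor -x is in M, then -1 = y + r x = z - s x; combining with weights s and r gives
   -(r + s) = s y + r z in M. *)
have Mtot x : M x \/ M (- x).
  have [|nx] := pselect (M x); first by left.
  have [|nnx] := pselect (M (- x)); first by right.
  have [r [y [r0 My ry]]] := Mmax _ nx; have [s [z [s0 Mz sz]]] := Mmax _ nnx.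
  exfalso; have rs : 0 < r + s.
    rewrite lt_def addr_ge0// andbT; apply/eqP => rs; apply: M1.
    by rewrite ry (_ : r = 0) ?cR0 ?scale0r ?addr0//; lra.
  apply: M1; rewrite -[- 1]scale1r -cR1 -(mulVf (lt0r_neq0 rs)) cRM -scalerA.
  apply: (MZ); first by rewrite invr_ge0 ltW.
  have -> : cR (r + s) *: (- 1 : B) = cR s *: y + cR r *: z.
    have -> : y = - 1 - cR r *: x by rewrite ry addrK.
    have -> : z = - 1 + cR s *: x by rewrite sz scalerN subrK.
    rewrite scalerBr scalerDr !scalerA -!cRM cRD scalerDl [r * s]mulrC.
    by ncring.
  by apply: (MD); apply: (MZ).
have Mr r : 0 <= r -> M (rcst B r) by move=> r0; apply: MZ => //; exact: PM.
have Mr0 r : M (rcst B r) -> 0 <= r.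
  move=> h; rewrite leNgt; apply/negP => r0; apply: M1.
  have -> : - 1 = cR (- r^-1) *: rcst B r.
    by rewrite rcstZ mulNr mulVf ?lt_eqF// /rcst cRN cR1 scaleN1r.
  by apply: MZ => //; rewrite oppr_ge0 invr_le0 ltW.
(* v is the cut of x: all scalars below v are below x, all scalars above v are above x. *)
pose G x v := forall a, (a < v -> M (x - rcst B a)) /\ (v < a -> M (rcst B a - x)).
have GE x : exists v, G x v.
  have [r /PM xr] := P_unit x; have [s /PM xs] := P_unit (- x).
  pose S := [set a | M (x - rcst B a)].
  have Sr a : S a -> a <= r.
    move=> xa; have := Mr0 (r - a); rewrite subr_ge0; apply.
    by rewrite rcstB -[rcst B r](subrK x) -addrA; exact: MD.
  have hS : has_sup S.
    split; last by exists r => a; exact: Sr.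
    by exists (- s); move: xs; rewrite /S /= rcstN !opprK addrC.
  exists (sup S) => a; split=> [ha|ha].
    have [|b xb ab] := @sup_adherent _ _ (sup S - a) _ hS; first by rewrite subr_gt0.
    have -> : x - rcst B a = (x - rcst B b) + rcst B (b - a) by rewrite rcstB addrA subrK.
    by apply: MD => //; apply: Mr; lra.
  have [/(ub_le_sup hS.2)|] := Mtot (x - rcst B a); last by rewrite opprB.
  by rewrite leNgt ha.
have GU x v w : G x v -> G x w -> v = w.
  suff h v' w' : G x v' -> G x w' -> ~ v' < w'.
    by move=> xv xw; apply/eqP; rewrite eq_le !leNgt; apply/andP; split; apply/negP; exact: h.
  (* At one third and two thirds of the gap, x <= a and b <= x, which puts the negative scalar a - b
     in M. *)
  move=> xv xw vw; pose a := v' + (w' - v') / 3; pose b := v' + (w' - v') / 3 * 2.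
  have h1 : M (rcst B a - x) by apply: (xv a).2; rewrite /a; lra.
  have h2 : M (x - rcst B b) by apply: (xw b).1; rewrite /b; lra.
  have : M (rcst B (a - b)) by rewrite rcstB -[rcst B a](subrK x) -addrA; exact: MD.
  by move/Mr0; rewrite /a /b; lra.
have [f fG] := choice GE.
have GN x v : G x v -> G (- x) (- v).
  move=> xv a; split=> h.
    by have := (xv (- a)).2; rewrite rcstN addrC; apply; lra.
  have := (xv (- a)).1; rewrite rcstN !opprK addrC; apply; lra.
have GD x y v w : G x v -> G y w -> G (x + y) (v + w).
  move=> xv yw a; pose d := (a - (v + w)) / 2.
  have -> : a = (v + d) + (w + d) by rewrite /d; field.
  rewrite rcstD; split=> h.
    rewrite opprD addrACA; apply: MD; [apply: (xv _).1|apply: (yw _).1]; lra.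
  rewrite opprD addrACA; apply: MD; [apply: (xv _).2|apply: (yw _).2]; lra.
have GP r x v : 0 < r -> G x v -> G (cR r *: x) (r * v).
  move=> r0 xv a; have -> : a = r * (a / r) by field; lra.
  rewrite -rcstZ -!scalerBr; split; rewrite ltr_pM2l// => h; apply: MZ.
  - exact: ltW.
  - exact: (xv _).1.
  - exact: ltW.
  - exact: (xv _).2.
have G0 : G 0 0.
  move=> a; split=> h; last by rewrite subr0; apply: Mr; exact: ltW.
  by rewrite sub0r -rcstN; apply: Mr; lra.
exists f; split.
- by move=> x y; apply: GU (fG _) _; exact: GD.
- move=> r x; apply: GU (fG _) _; have [r0|r0|<-] := ltgtP 0 r.
  + exact: GP.
  + rewrite -[r]opprK cRN scaleNr mulNr; apply: GN; apply: GP => //; lra.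
  + by rewrite cR0 scale0r mul0r.
- apply: GU (fG _) _ => a; rewrite -{1 2}rcst1 -!rcstB; split=> h; apply: Mr; lra.
- move=> x /PM Mx; rewrite leNgt; apply/negP => fx.
  have h : M (rcst B (f x / 2) - x) by apply: (fG x _).2; lra.
  by have := MD _ _ h Mx; rewrite subrK => /Mr0; lra.
Qed.

End ConeFunctional.

(** * The seminorm defined by all positive functionals *)

Section PositiveFunctionals.
Variables (R : realType) (B : starAlgType R).
Implicit Types (x y b c : B) (f : B -> R) (r s : R).

(* The real part of a positive linear functional on B. *)
Definition posfun f := [/\ forall x y, f (x + y) = f x + f y,
  forall r x, f (cR r *: x) = r * f x, forall x, f (star x) = f x &
  forall b, 0 <= f (star b * b)].

Lemma posfun_conj f c : posfun f -> posfun (fun x => f (star c * x * c)).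
Proof.
move=> [fD fZ fs fp]; split=> [x y|r x|x|b].
- by rewrite mulrDr mulrDl fD.
- by rewrite starAr starAl fZ.
- by rewrite -fs !starM !starK mulrA.
- by rewrite mulrA -starM -mulrA; exact: fp.
Qed.

Lemma posfunN f x : posfun f -> f (- x) = - f x.
Proof. by move=> [_ fZ _ _]; rewrite -scaleN1r -cR1 -cRN fZ mulN1r. Qed.

Lemma posfunB f x y : posfun f -> f (x - y) = f x - f y.
Proof. by move=> pf; have [fD _ _ _] := pf; rewrite fD posfunN. Qed.

Lemma posfun1 f : posfun f -> 0 <= f 1.
Proof. by move=> [_ _ _ fp]; have := fp 1; rewrite star1 mulr1. Qed.

Lemma posfun_sum f I (s : seq I) (F : I -> B) : posfun f ->
  f (\sum_(i <- s) F i) = \sum_(i <- s) f (F i).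
Proof.
move=> pf; have [fD _ _ _] := pf; elim: s => [|i s ih]; last by rewrite !big_cons fD ih.
by rewrite !big_nil -(subrr 0) posfunB// subrr.
Qed.

Lemma posfun_rcst f r : posfun f -> f (rcst B r) = r * f 1.
Proof. by move=> [_ fZ _ _]; rewrite /rcst fZ. Qed.

(** Written without dividing by [f 1], so that functionals with [f 1 = 0] need no separate
    treatment. *)
Definition posbd r x := 0 <= r /\ forall f, posfun f -> f (star x * x) <= r ^+ 2 * f 1.

Lemma posbd_le r s x : r <= s -> posbd r x -> posbd s x.
Proof.
move=> rs [r0 xr]; split=> [|f pf]; first exact: le_trans rs.
apply: le_trans (xr f pf) _; rewrite ler_wpM2r ?posfun1// lerXn2r ?nnegrE//.
exact: le_trans rs.
Qed.

Lemma posbd_closed r x : (forall e, 0 < e -> posbd (r + e) x) -> posbd r x.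
Proof.
move=> h; have r0 : 0 <= r by apply/ler_addgt0Pr => e e0; exact: (h e e0).1.
split=> // f pf; apply/ler_addgt0Pr => e e0.
have f1 := posfun1 pf.
(* For d <= 1, (r + d)^2 exceeds r^2 by at most d (2 r + 1). The last summand 1 keeps c positive
   when [f 1 = 0]. *)
pose c := (2 * r + 1) * f 1 + 1; pose d := Num.min 1 (e / c).
have c0 : 0 < c by rewrite ltr_wpDl// mulr_ge0//; lra.
have d0 : 0 < d by rewrite lt_min ltr01 divr_gt0.
have d1 : d <= 1 by rewrite ge_min lexx.
have dc : d * c <= e by rewrite -ler_pdivlMr// ge_min lexx orbT.
apply: le_trans ((h d d0).2 f pf) _.
have dd : d * d <= d by rewrite -[leRHS]mulr1 ler_wpM2l// ltW.
have : d * d * f 1 <= d * f 1 by rewrite ler_wpM2r.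
by rewrite /c in dc; rewrite !expr2; nra.
Qed.

(** The bound on x is applied to the functional f conjugated by y. *)
Lemma posbdM r s x y : posbd r x -> posbd s y -> posbd (r * s) (x * y).
Proof.
move=> [r0 xr] [s0 ys]; split=> [|f pf]; first exact: mulr_ge0.
have h := xr _ (posfun_conj y pf); rewrite /= mulr1 in h.
have -> : star (x * y) * (x * y) = star y * (star x * x) * y by rewrite starM !mulrA.
apply: le_trans h _; rewrite exprMn -[_ * _ * f 1]mulrA ler_wpM2l ?exprn_ge0//.
exact: ys.
Qed.

Lemma posbdZ (a : R) r x : posbd r x -> posbd (`|a| * r) (cR a *: x).
Proof.
move=> [r0 xr]; split=> [|f pf]; first exact: mulr_ge0.
have [_ fZ _ _] := pf; rewrite starZr starAl starAr !fZ exprMn real_normK ?num_real//.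
rewrite mulrA -expr2 -[_ * _ * f 1]mulrA.
by rewrite ler_wpM2l ?sqr_ge0//; exact: xr.
Qed.

(** For [h = x * star x], the bound under conjugation by [star x] gives f(h^2) <= s^2 f(h), and
    f((s^2 - h)^2) >= 0 then yields f(h) <= s^2 f(1). Dividing by s^2 requires s > 0, hence the
    detour through [posbd_closed]. *)
Lemma posbd_star r x : posbd r x -> posbd r (star x).
Proof.
suff h s : 0 < s -> posbd s x -> posbd s (star x).
  move=> xr; apply: posbd_closed => e e0; apply: h; first by rewrite ltr_wpDl// xr.1.
  by apply: posbd_le xr; rewrite lerDl ltW.
move=> s0 [_ xs]; split=> [|f pf]; first exact: ltW.
rewrite starK; set h := x * star x.
have hs : star h = h by rewrite /h starM starK.
have [fD fZ fs fp] := pf.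
have h1 : f (h * h) <= s ^+ 2 * f h.
  have := xs _ (posfun_conj (star x) pf).
  by rewrite starK mulr1 /h !mulrA.
have := fp (rcst B (s ^+ 2) - h).
rewrite starB star_rcst hs mulrBr !mulrBl !posfunB// !rcst_mull !rcst_mulr.
rewrite !fZ /rcst ?fZ => h2.
have s2 : 0 < s ^+ 2 by rewrite exprn_gt0.
by rewrite -(ler_pM2l s2); lra.
Qed.

(** Positivity of f on the square of c x - a y bounds the cross term, in place of the Cauchy-Schwarz
    inequality. *)
Lemma posbdD r s x y : posbd r x -> posbd s y -> posbd (r + s) (x + y).
Proof.
suff h (a c : R) : 0 < a -> 0 < c -> posbd a x -> posbd c y -> posbd (a + c) (x + y).
  move=> xr ys; apply: posbd_closed => e e0.
  have -> : r + s + e = (r + e / 2) + (s + e / 2) by field.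
  have r0 := xr.1; have s0 := ys.1.
  by apply: h; [lra|lra|apply: posbd_le xr; lra|apply: posbd_le ys; lra].
move=> a0 c0 [_ xa] [_ yc]; split=> [|f pf]; first by lra.
have [fD fZ fs fp] := pf.
have hx := xa f pf; have hy := yc f pf.
have := fp (cR c *: x - cR a *: y).
rewrite starB !starZr mulrBr !mulrBl !posfunB// !starAl !starAr !fZ => h.
rewrite starD mulrDr !mulrDl !fD.
have xy : f (star y * x) = f (star x * y) by rewrite -fs starM starK.
rewrite xy in h *.
have ac : 0 < a * c by exact: mulr_gt0.
rewrite -(ler_pM2l ac) !expr2.
have e1 : c * (c * f (star x * x)) <= c * (c * (a ^+ 2 * f 1)).
  by rewrite !ler_pM2l.
have e2 : a * (a * f (star y * y)) <= a * (a * (c ^+ 2 * f 1)).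
  by rewrite !ler_pM2l.
have e3 : a * c * f (star x * x) <= a * c * (a ^+ 2 * f 1) by rewrite ler_pM2l.
have e4 : a * c * f (star y * y) <= a * c * (c ^+ 2 * f 1) by rewrite ler_pM2l.
rewrite !expr2 in e1 e2 e3 e4.
by lra.
Qed.

End PositiveFunctionals.

(** * Norming positive functionals on a C*-algebra *)

Section NormingFunctional.
Variables (R : realType) (A : cstarAlgType R).
Implicit Types (x y p : A) (r : R).

(** This happens only in the zero algebra: 0 <= -r <= 0 forces the unit to have norm 0. *)
Lemma cpos_lt0 r x : r < 0 -> cpos (rcst A r) -> nrm x = 0.
Proof.
move=> r0 pr; have nr0 : 0 <= - r by lra.
have h : cpos (rcst A 0 - rcst A (- r)) by rewrite -rcstB sub0r opprK.
have := nrm_le (lexx 0) (cpos_rcst A nr0) h.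
rewrite nrmZ ger0_norm// => h1.
have n1 : nrm (1 : A) = 0.
  apply/eqP; rewrite eq_le nrm_ge0 andbT; have := nrm_ge0 (1 : A); nra.
apply/eqP; rewrite eq_le nrm_ge0 andbT -[x]mulr1.
by apply: le_trans (nrmM _ _) _; rewrite n1 mulr0.
Qed.

(** If s, the norm of p, exceeded r, then p - s could be added to the positive cone without reaching
    -1, giving f with f(p) >= s f(1) and f(1) = 1. *)
Lemma nrm_le_posfun p r : cpos p -> 0 <= r ->
  (forall f, posfun f -> f p <= r * f 1) -> nrm p <= r.
Proof.
move=> pp r0 h; rewrite leNgt; apply/negP; set s := nrm p => rs.
(* Testing [y + star y] puts every skew-adjoint y in P together with -y, which forces f to be
   invariant under [star]. *)
pose P : set A := [set y | exists2 t, 0 <= t & cpos (y + star y - cR t *: (p - rcst A s))].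
have c0 : cpos (0 : A) by have := cpos_rcst A (lexx 0); rewrite /rcst cR0 scale0r.
have Pp x : cpos (x + star x) -> P x by exists 0; rewrite // cR0 scale0r subr0.
have PD x y : P x -> P y -> P (x + y).
  move=> [t t0 xt] [u u0 yu]; exists (t + u); first exact: addr_ge0.
  have -> : x + y + star (x + y) - cR (t + u) *: (p - rcst A s) =
    (x + star x - cR t *: (p - rcst A s)) + (y + star y - cR u *: (p - rcst A s)).
    by rewrite starD cRD scalerDl; ncring.
  exact: cposD.
have PZ a x : 0 <= a -> P x -> P (cR a *: x).
  move=> a0 [t t0 xt]; exists (a * t); first exact: mulr_ge0.
  by rewrite starZr cRM -scalerA -scalerDr -scalerBr; exact: cposZ.
have PU x : exists a, P (rcst A a - x).
  exists (nrm (x + star x) / 2); apply: Pp.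
  rewrite starB star_rcst; set a := nrm _.
  have -> : rcst A (a / 2) - x + (rcst A (a / 2) - star x) = rcst A a - (x + star x).
    by rewrite {3}(_ : a = a / 2 + a / 2) ?rcstD; [ncring|field].
  by apply: cpos_sub => //; rewrite starD starK addrC.
have P1 : P 1.
  by apply: Pp; rewrite star1 -rcst1 -rcstD; apply: cpos_rcst; lra.
(* -1 in P would mean t p <= t s - 2, which contradicts that t p has norm t s. *)
have Pn1 : ~ P (- 1).
  move=> [t t0]; rewrite starN star1.
  have -> : - 1 - 1 - cR t *: (p - rcst A s) = rcst A (t * s - 2) - cR t *: p.
    by rewrite scalerBr rcstZ rcstB (_ : 2 = 1 + 1)// [rcst A (1 + 1)]rcstD rcst1; ncring.
  move=> ht; have tp := cposZ t0 pp; have h1 : cpos (rcst A (t * s - 2)).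
    by rewrite -[rcst _ _](subrK (cR t *: p)); exact: cposD.
  have [n0|n0] := ltP (t * s - 2) 0.
    by have := cpos_lt0 p n0 h1; rewrite -/s; lra.
  by have := nrm_le n0 tp ht; rewrite nrmZ ger0_norm// -/s; lra.
have [f [fD fZ f1 fp]] := cone_functional PD PZ PU P1 Pn1.
have fN x : f (- x) = - f x by rewrite -scaleN1r -cR1 -cRN fZ mulN1r.
have pf : posfun f.
  split=> // [x|b].
    have sk y : star y = - y -> 0 <= f y.
      by move=> ys; apply: fp; apply: Pp; rewrite ys subrr.
    have h1 : 0 <= f (x - star x) by apply: sk; rewrite starB starK opprB.
    have h2 : 0 <= f (star x - x) by apply: sk; rewrite starB starK opprB.
    by move: h1 h2; rewrite !fD !fN => h1 h2; apply/eqP; rewrite eq_le; lra.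
  apply: fp; apply: Pp; rewrite starM starK.
  by apply: cposD; exact: cpos_mulstar.
have := h f pf; rewrite f1 mulr1.
suff : 0 <= f (p - rcst A s) by rewrite fD fN /rcst fZ f1; lra.
apply: fp; exists 2; first by lra.
rewrite starB star_rcst pp.1 (_ : cR 2 *: _ = (p - rcst A s) + (p - rcst A s)) ?subrr//.
by rewrite (_ : 2 = 1 + 1)// cRD cR1 scalerDl !scale1r.
Qed.

End NormingFunctional.

(** * Positivity in M_n(A) *)

Definition mxstar (R : realType) (B : starAlgType R) (k : nat) : starAlgType R := mxalg B k.

Section MatrixEntries.
Variables (R : realType) (B : starAlgType R) (k : nat).
Implicit Types x y : mxstar B k.

Definition munit (i j : 'I_k) (a : B) : mxstar B k := mxunit i j a.

Definition entry x (i j : 'I_k) : B := (x : 'M[B]_k) i j.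

Lemma entryP x y : (forall i j, entry x i j = entry y i j) -> x = y.
Proof. by move=> h; apply/matrixP => i j; exact: h. Qed.

Lemma entryD x y i j : entry (x + y) i j = entry x i j + entry y i j.
Proof. exact: mxE. Qed.

Lemma entryB x y i j : entry (x - y) i j = entry x i j - entry y i j.
Proof. by rewrite /entry !mxE. Qed.

Lemma entryZ a x i j : entry (a *: x) i j = a *: entry x i j.
Proof. exact: mxE. Qed.

Lemma entryM x y i j : entry (x * y) i j = \sum_l entry x i l * entry y l j.
Proof. exact: mxE. Qed.

Lemma entry_star x i j : entry (star x) i j = star (entry x j i).
Proof. by rewrite [LHS]mxE mxE. Qed.

Lemma entry1 i j : entry 1 i j = (i == j)%:R.
Proof. exact: mxE. Qed.

Lemma entry_munit i j a p q : entry (munit i j a) p q = a *+ ((p == i) && (q == j)).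
Proof. exact: mxE. Qed.

Lemma entry_sum I (s : seq I) (F : I -> mxstar B k) i j :
  entry (\sum_(l <- s) F l) i j = \sum_(l <- s) entry (F l) i j.
Proof.
elim: s => [|l s ih]; first by rewrite !big_nil [LHS]mxE.
by rewrite !big_cons entryD ih.
Qed.

Lemma munitD i j a b : munit i j (a + b) = munit i j a + munit i j b.
Proof. by apply: entryP => p q; rewrite entryD !entry_munit mulrnDl. Qed.

Lemma munitB i j a b : munit i j (a - b) = munit i j a - munit i j b.
Proof. by apply: entryP => p q; rewrite entryB !entry_munit mulrnBl. Qed.

Lemma munitZ i j (c : cplx R) a : munit i j (c *: a) = c *: munit i j a.
Proof.
apply: entryP => p q; rewrite entryZ !entry_munit.
by case: (_ && _); rewrite ?mulr1n// !mulr0n scaler0.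
Qed.

Lemma star_munit i j a : star (munit i j a) = munit j i (star a).
Proof. exact: star_mxunit. Qed.

Lemma munitM i j l a b : munit i j a * munit j l b = munit i l (a * b).
Proof.
apply: entryP => p q; rewrite entryM entry_munit (bigD1 j)//= big1 => [|m mj].
  rewrite !entry_munit eqxx andbT /= addr0.
  by case: (p == i); case: (q == l); rewrite ?mulr1n ?mulr0n ?mulr0 ?mul0r.
by rewrite !entry_munit (negPf mj) andbF mulr0n mul0r.
Qed.

Lemma munit_sum x : x = \sum_i \sum_j munit i j (entry x i j).
Proof.
apply: entryP => p q; rewrite entry_sum (bigD1 p)//= entry_sum (bigD1 q)//=.
rewrite entry_munit !eqxx mulr1n big1 => [|j jq].
  rewrite big1 ?addr0// => i ip; rewrite entry_sum big1// => j _.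
  by rewrite entry_munit eq_sym (negPf ip).
by rewrite entry_munit eqxx eq_sym (negPf jq).
Qed.

End MatrixEntries.

(** * The functional norm on matrices, and squares detected by functionals *)

Section MatrixCStar.
Variables (R : realType) (A : cstarAlgType R) (k : nat).
Local Notation M := (mxstar A k).
Implicit Types (x y : M) (a : A) (r e : R).

Lemma posfun_le_nrm (f : A -> R) a : posfun f -> f (star a * a) <= nrm a ^+ 2 * f 1.
Proof.
move=> pf; have [fD fZ fs fp] := pf.
have : cpos (rcst A (nrm a ^+ 2) - star a * a).
  by apply: cpos_sub; [rewrite starM starK|rewrite nrm_sqr].
move=> /cpos_sqrt[b [bs _ bb _]]; have := fp b.
by rewrite bs bb posfunB// posfun_rcst// subr_ge0.
Qed.

Lemma posfun_munit (f : M -> R) j : posfun f -> posfun (fun a => f (munit j j a)).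
Proof.
move=> [fD fZ fs fp]; split=> [a b|r a|a|b].
- by rewrite munitD fD.
- by rewrite munitZ fZ.
- by rewrite -star_munit fs.
- by have := fp (munit j j b); rewrite star_munit munitM.
Qed.

Lemma posfun_entry (f : A -> R) j : posfun f -> posfun (fun x : M => f (entry x j j)).
Proof.
move=> pf; have [fD fZ fs fp] := pf; split=> [x y|r x|x|b].
- by rewrite entryD fD.
- by rewrite entryZ fZ.
- by rewrite entry_star fs.
- rewrite entryM posfun_sum//; apply: sumr_ge0 => i _.
  by rewrite entry_star.
Qed.

(** The (j, j) entry of [star x * x] is a sum of squares, one of which comes from the (i, j) entry
    of x; norming functionals of A are evaluated on it. *)
Lemma posbd_entry r x i j : posbd r x -> nrm (entry x i j) <= r.
Proof.
move=> [r0 xr]; rewrite -(@ler_pXn2r _ 2) ?nnegrE ?nrm_ge0// -nrm_sqr.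
apply: nrm_le_posfun; [exact: cpos_mulstar|exact: exprn_ge0|move=> f pf].
have [fD fZ fs fp] := pf.
have := xr _ (posfun_entry j pf); rewrite entryM posfun_sum// entry1 eqxx.
apply: le_trans; rewrite (bigD1 i)//= entry_star lerDl.
by apply: sumr_ge0 => l _; rewrite entry_star.
Qed.

Lemma posbd_munit i j a : posbd (nrm a) (munit i j a : M).
Proof.
split=> [|f pf]; first exact: nrm_ge0.
rewrite star_munit munitM.
apply: le_trans (posfun_le_nrm a (posfun_munit j pf)) _.
rewrite ler_wpM2l ?exprn_ge0 ?nrm_ge0//.
have [fD fZ fs fp] := pf.
(* 1 - e_jj is a projection, so f(e_jj) <= f(1). *)
have := fp (1 - munit j j 1); rewrite starB star1 star_munit star1.
rewrite mulrBr mulr1 mulrBl mul1r munitM mulr1 subrr subr0 posfunB//.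
by rewrite subr_ge0.
Qed.

Lemma posbd_sum I (s : seq I) (F : I -> M) (r : I -> R) :
  (forall i, posbd (r i) (F i)) -> posbd (\sum_(i <- s) r i) (\sum_(i <- s) F i).
Proof.
move=> h; elim: s => [|i s ih]; last by rewrite !big_cons; exact: posbdD.
rewrite !big_nil; split=> // f pf.
by rewrite mulr0 -(subrr 0) posfunB// subrr expr0n mul0r.
Qed.

Lemma posbd_entries x : posbd (\sum_i \sum_j nrm (entry x i j)) x.
Proof.
rewrite {2}[x]munit_sum; apply: posbd_sum => i; apply: posbd_sum => j.
exact: posbd_munit.
Qed.

Lemma posbd_bound : complete_bound (fun r (x : M) => posbd r x).
Proof.
split.
- by move=> r x [].
- by move=> r s x; exact: posbd_le.
- by move=> x; exists (\sum_i \sum_j nrm (entry x i j)); exact: posbd_entries.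
- by move=> r s x y; exact: posbdD.
- by move=> r s x y; exact: posbdM.
- by move=> a r x; exact: posbdZ.
- by move=> r x; exact: posbd_star.
- move=> x x0; apply: entryP => i j; rewrite [RHS]mxE; apply: nrm_eq0.
  by apply/eqP; rewrite eq_le nrm_ge0 (posbd_entry i j x0).
- by move=> r x; exact: posbd_closed.
- move=> u hu.
  have el i j : exists l : A, forall e, 0 < e ->
      exists N, forall n, (N <= n)%N -> nrm (entry (u n) i j - l) <= e.
    apply: (bd_cauchy (nrm_bound A)) => e e0; have [N hN] := hu e e0.
    by exists N => n /hN /posbd_entry; rewrite -entryB; exact.
  (* The entrywise limits exist by [el], so the default 0 is never taken. *)
  pose l : M := \matrix_(i, j) xget 0 [set l | forall e, 0 < e ->
      exists N, forall n, (N <= n)%N -> nrm (entry (u n) i j - l) <= e].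
  have ll i j e : 0 < e -> exists N, forall n, (N <= n)%N -> nrm (entry (u n - l) i j) <= e.
    move=> e0; have := @xgetPex A 0 _ (el i j) e e0; rewrite /= => -[N hN].
    by exists N => n /hN; rewrite entryB /l [entry (\matrix_(_, _) _) _ _]mxE.
  exists l => e e0.
  (* k^2 + 1 rather than k^2, to divide by a nonzero number when k = 0. *)
  pose d := e / (k * k).+1%:R.
  have k0 : 0 < (k * k).+1%:R :> R by rewrite ltr0n.
  have d0 : 0 < d by exact: divr_gt0.
  have [N hN] := choice (fun p : 'I_k * 'I_k => ll p.1 p.2 d d0).
  exists (\max_p N p) => n Nn; apply: posbd_le (posbd_entries _).
  apply: (@le_trans _ _ (\sum_(i < k) \sum_(j < k) d)).
    apply: ler_sum => i _; apply: ler_sum => j _; apply: (hN (i, j)).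
    by apply: leq_trans Nn; exact: (leq_bigmax (i, j)).
  rewrite !sumr_const card_ord -mulrnA -mulr_natr.
  by rewrite mulrAC ler_pdivrMr// ler_wpM2l ?ler_nat ?ltW.
Qed.

(** From f((s - x)^2) >= 0 and f(x^2) <= s^2 f(1) one gets 2 s f(x) <= 2 s^2 f(1). *)
Lemma posbd_le_id r x f : posbd r x -> star x = x -> posfun f -> f x <= r * f 1.
Proof.
move=> xr xs pf; suff h s : 0 < s -> posbd s x -> f x <= s * f 1.
  have f1 := posfun1 pf; apply/ler_addgt0Pr => e e0.
  have e1 : 0 < e / (f 1 + 1) by apply: divr_gt0; lra.
  have s0 : 0 < r + e / (f 1 + 1) by rewrite ltr_wpDl// xr.1.
  apply: le_trans (h _ s0 _) _; first by apply: posbd_le xr; lra.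
  rewrite mulrDl lerD2l -mulrA ler_piMr ?(ltW e0)//.
  by rewrite ler_pdivrMl ?ltr_wpDl// mulr1 lerDl.
move=> s0 [_ xs2]; have [fD fZ fs fp] := pf.
have := fp (rcst M s - x); rewrite starB star_rcst xs mulrBr !mulrBl !posfunB//.
rewrite !rcst_mull rcst_mulr !fZ /rcst ?fZ.
have := xs2 f pf; rewrite xs expr2 => h1 h2.
by rewrite -(ler_pM2l s0); lra.
Qed.

(* With y = r - x both positive, x y = (x y x + y x y) / r. *)
Lemma posfun_sqr_le r x f : 0 < r -> posbd r x -> star x = x ->
  (forall g : M -> R, posfun g -> 0 <= g x) -> posfun f -> f (x * x) <= r * f x.
Proof.
move=> r0 xr xs xp pf; pose y := rcst M r - x.
have ys : star y = y by rewrite starB star_rcst xs.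
have yp g : posfun g -> 0 <= g y.
  by move=> pg; rewrite posfunB// posfun_rcst// subr_ge0; exact: posbd_le_id.
have [fD fZ fs fp] := pf.
have h1 := yp _ (posfun_conj x pf); have h2 := xp _ (posfun_conj y pf).
rewrite xs ys /= in h1 h2.
have : f (x * y * x + y * x * y) = r * f (x * y).
  rewrite -fZ; congr f.
  have xy : x * y = y * x by rewrite /y mulrBl mulrBr rcst_mull rcst_mulr.
  have -> : x * y * x + y * x * y = x * y * (x + y)  by rewrite -xy; ncring.
  by rewrite [x + y]addrC subrK rcst_mulr.
have -> : f (x * y) = r * f x - f (x * x) by rewrite /y mulrBr posfunB// rcst_mulr fZ.
by rewrite fD => h; rewrite -(ler_pM2l r0); lra.
Qed.

(** As f is a real part, f(i x) = 0 says that its complex value at x is real. Hence all f vanish on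
    the self-adjoint ['i *: (x - star x)], and [posfun_sqr_le] makes this element 0. For
    self-adjoint x a square root is then taken by [sqrt_one_sub]. *)
Lemma posfun_pos x :
  (forall f : M -> R, posfun f -> 0 <= f x /\ f ('i *: x) = 0) ->
  exists b : M, x = star b * b.
Proof.
move=> xp.
have xs : star x = x.
  pose h : M := 'i *: (x - star x).
  have hs : star h = h by rewrite /h starZ conjCi starB starK scaleNr -scalerN opprB.
  have fh f : posfun f -> f h = 0.
    move=> pf; have [fD fZ fs fp] := pf.
    rewrite /h scalerBr posfunB// (xp f pf).2 sub0r.
    have -> : 'i *: star x = star (- 'i *: x) by rewrite starZ rmorphN /= conjCi opprK.
    by rewrite fs scaleNr posfunN// (xp f pf).2 !oppr0.
  have [r hr] := bd_ex posbd_bound h.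
  have hr1 : posbd (r + 1) h by apply: posbd_le hr; rewrite lerDl.
  have r1 : 0 < r + 1 by rewrite ltr_wpDl// hr.1.
  have h0 : h = 0.
    apply: (bd_sep posbd_bound); split=> // f pf.
    rewrite expr0n mul0r hs; apply: le_trans (posfun_sqr_le r1 hr1 hs _ pf) _.
      by move=> g /fh ->.
    by rewrite fh// mulr0.
  have : 'i *: h = 0 by rewrite h0 scaler0.
  rewrite /h scalerA mulii scaleN1r => /eqP; rewrite oppr_eq0 subr_eq0.
  by move=> /eqP.
have [r0 xr0] := bd_ex posbd_bound x.
pose r := r0 + 1; have xr : posbd r x by apply: posbd_le xr0; rewrite lerDl.
have r_gt0 : 0 < r by rewrite ltr_wpDl// xr0.1.
pose y := cR r^-1 *: (rcst M r - x).
have ys : star y = y by rewrite starZr starB star_rcst xs.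
(* f((r - x)^2) = r^2 f(1) - 2 r f(x) + f(x^2) is at most r^2 f(1), because f(x^2) <= r f(x). *)
have y1 : posbd 1 y.
  have -> : 1 = `|r^-1| * r by rewrite gtr0_norm ?invr_gt0// mulVf ?gt_eqF.
  apply: posbdZ; split=> [|f pf]; first exact: ltW.
  have [fD fZ fs fp] := pf.
  rewrite starB star_rcst xs mulrBr !mulrBl !posfunB//.
  rewrite !rcst_mull rcst_mulr !fZ /rcst ?fZ.
  have := posfun_sqr_le r_gt0 xr xs (fun g pg => (xp g pg).1) pf.
  have := mulr_ge0 (ltW r_gt0) (xp f pf).1.
  by rewrite expr2; lra.
have [z [zs _ zz _]] := sqrt_one_sub posbd_bound y1 ys.
exists (cR (Num.sqrt r) *: (1 - z)).
rewrite starZr starB star1 zs starAl starAr zz scalerA -cRM -expr2 sqr_sqrtr ?ltW//.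
by rewrite scalerBr scaler_divK ?gt_eqF// opprB addrCA subrr addr0.
Qed.

End MatrixCStar.

(** * Lifting from C_k *)

Section SumsOfSquares.
Variables (R : realType).

(** Sums of squares are closed under addition without any square root, and already suffice for
    positive functionals to be nonnegative. *)
Definition sos (B : starAlgType R) (x : B) :=
  exists s : seq B, x = \sum_(b <- s) star b * b.

Lemma sosD (B : starAlgType R) (x y : B) : sos x -> sos y -> sos (x + y).
Proof. by move=> [s ->] [t ->]; exists (s ++ t); rewrite big_cat. Qed.

Lemma sos0 (B : starAlgType R) : sos (0 : B).
Proof. by exists [::]; rewrite big_nil. Qed.

Lemma sos_sum (B : starAlgType R) I (s : seq I) (F : I -> B) :
  (forall i, sos (F i)) -> sos (\sum_(i <- s) F i).
Proof.
move=> h; elim: s => [|i s ih]; first by rewrite big_nil; exact: sos0.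
by rewrite big_cons; exact: sosD.
Qed.

Lemma posfun_sos (B : starAlgType R) (f : B -> R) (x : B) :
  posfun f -> sos x -> 0 <= f x /\ f ('i *: x) = 0.
Proof.
move=> pf [s ->]; have [fD fZ fs fp] := pf; split.
  by rewrite posfun_sum//; apply: sumr_ge0.
set h := \sum_(_ <- _) _; have hs : star h = h.
  by rewrite star_sum; apply: eq_bigr => b _; rewrite starM starK.
have : f ('i *: h) = - f ('i *: h).
  by rewrite -{1}fs starZ conjCi hs scaleNr posfunN.
by lra.
Qed.

(** One square suffices: that of the matrix with v as first row and zeros elsewhere. For n = 0 there
    is no first row, hence the case split. *)
Lemma sos_gram (A : starAlgType R) n (v : 'I_n -> A) :
  sos (\matrix_(i, j) (star (v i) * v j) : mxstar A n).
Proof.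
case: n v => [|n] v; first by exists [::]; apply: entryP => -[].
exists [:: \matrix_(p, j) (v j *+ (p == ord0)) : mxstar A n.+1].
rewrite big_seq1; apply: entryP => i j; rewrite entryM [LHS]mxE big_ord_recl big1 ?addr0.
  by rewrite entry_star /entry !mxE eqxx !mulr1n.
by move=> p _; rewrite /entry !mxE !mulr0n mulr0.
Qed.

End SumsOfSquares.

Section Evaluation.
Variable R : realType.

Definition ev (t : unitI R) (f : C01 R) : cplx R := val f t.

Lemma evD t f g : ev t (f + g) = ev t f + ev t g. Proof. by []. Qed.
Lemma evZ t a f : ev t (a *: f) = a * ev t f. Proof. by []. Qed.
Lemma evM t (f g : (C01 R : starAlgType R)) : ev t (f * g) = ev t f * ev t g. Proof. by []. Qed.
Lemma ev1 t : ev t (1 : (C01 R : starAlgType R)) = 1. Proof. by []. Qed.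
Lemma ev_star t f : ev t (star f) = (ev t f)^*. Proof. by []. Qed.
Lemma ev_sum t I (s : seq I) (F : I -> (C01 R : starAlgType R)) :
  ev t (\sum_(i <- s) F i) = \sum_(i <- s) ev t (F i).
Proof. by elim: s => [|i s ih]; rewrite ?big_nil// !big_cons -ih. Qed.

Lemma ev_inj f g : (forall t, ev t f = ev t g) -> f = g.
Proof. by move=> h; apply/val_inj/funext. Qed.

Lemma real_cts (g : R -> R) : continuous g ->
  (fun x : unitI R => cR (g (sval x))) \in @cts R.
Proof.
move=> cg; apply/asboolP => x; apply/(@cvgrPdist_lt _ _ _ _ (@nbhs_filter (unitI R) x)) => -[e ei].
rewrite ltcE /= => /andP[/eqP -> e0].
have : g ((set_val : unitI R -> R) z) @[z --> x] --> g (set_val x : R).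
  by apply: continuous_comp; [exact: initial_continuous|exact: cg].
move=> /(@cvgrPdist_lt _ _ _ _ (@nbhs_filter (unitI R) x))/(_ e e0).
apply: (@filterS _ _ (@nbhs_filter (unitI R) x)) => z.
by rewrite -cRB cR_norm cR_lt.
Qed.

Definition real_C01 (g : R -> R) (cg : continuous g) : C01 R :=
  exist (fun f => f \in @cts R) _ (real_cts cg).

Lemma ev_real (g : R -> R) (cg : continuous g) t : ev t (real_C01 cg) = cR (g (sval t)).
Proof. by []. Qed.

Lemma unitI_mem0 : (0 : R) \in (`[0, 1]%classic : set R).
Proof. by rewrite inE /= in_itv /= lexx ler01. Qed.

Lemma unitI_mem1 : (1 : R) \in (`[0, 1]%classic : set R).
Proof. by rewrite inE /= in_itv /= lexx ler01. Qed.

Definition end0 : unitI R := exist _ 0 unitI_mem0.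
Definition end1 : unitI R := exist _ 1 unitI_mem1.

Lemma unitI01 (t : unitI R) : 0 <= sval t <= 1.
Proof. by case: t => t /=; rewrite inE /= in_itv. Qed.

End Evaluation.

Section QuotientMap.
Variables (R : realType) (A : cstarAlgType R) (J : closedIdeal A).

Definition cqstar : starAlgType R := cquot J.
Definition cq (x : A) : cqstar := cproj J x.

Lemma cqD x y : cq (x + y) = cq x + cq y. Proof. exact: (raddfD (cproj J)). Qed.
Lemma cqB x y : cq (x - y) = cq x - cq y. Proof. exact: (raddfB (cproj J)). Qed.
Lemma cqZ a x : cq (a *: x) = a *: cq x. Proof. exact: sprojZ. Qed.
Lemma cqM x y : cq (x * y) = cq x * cq y. Proof. exact: cprojM. Qed.
Lemma cq1 : cq 1 = 1. Proof. by []. Qed.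
Lemma cq_star x : cq (star x) = star (cq x). Proof. by rewrite /cq -cproj_star. Qed.
Lemma cq_sum I (s : seq I) (F : I -> A) : cq (\sum_(i <- s) F i) = \sum_(i <- s) cq (F i).
Proof. exact: (raddf_sum (cproj J)). Qed.

Lemma cq_surj (y : cqstar) : cq (srepr (y : cquot J)) = y.
Proof. exact: sreprK. Qed.

End QuotientMap.

(** * Completely positive maps given by Gram matrices *)

Section MatrixPairing.
Variables (R : realType) (A : starAlgType R) (k m : nat) (t : unitI R) (d : 'I_m -> 'I_k -> A).

Definition gram (p q : 'I_k) : A := \sum_u star (d u p) * d u q.

(** Evaluation at t followed by the map from M_k to A whose Choi matrix is [gram]. *)
Definition pairing (y : mxstar (C01 R) k) : A := \sum_p \sum_q ev t (entry y p q) *: gram p q.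

Lemma pairing_linear : linear pairing.
Proof.
move=> a x y; rewrite /pairing scaler_sumr -big_split; apply: eq_bigr => p _.
rewrite scaler_sumr -big_split; apply: eq_bigr => q _ /=.
by rewrite entryD entryZ evD evZ scalerDl scalerA.
Qed.

HB.instance Definition _ := GRing.isLinear.Build _ _ _ _ pairing pairing_linear.

Lemma pairing_munit i j f : pairing (munit i j f) = ev t f *: gram i j.
Proof.
rewrite /pairing (bigD1 i)//= (bigD1 j)//= entry_munit !eqxx mulr1n.
rewrite big1 => [|q qj]; last by rewrite entry_munit eqxx (negPf qj) mulr0n scale0r.
rewrite addr0 big1 ?addr0// => p pi; rewrite big1// => q _.
by rewrite entry_munit (negPf pi) mulr0n scale0r.
Qed.

Lemma pairing1 : pairing 1 = \sum_p gram p p.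
Proof.
apply: eq_bigr => p _; rewrite (bigD1 p)//= big1 => [|q qp].
  by rewrite entry1 eqxx ev1 scale1r addr0.
by rewrite entry1 eq_sym (negPf qp) scale0r.
Qed.

(** Choi's criterion: factoring the Choi matrix through d splits the image into Gram matrices of the
    vectors [v l r u], for l, r and u running over the rows of b, of its entries and of d. *)
Lemma pairing_sos n (b : 'M[mxstar (C01 R) k]_n) :
  sos (map_mx pairing (adjmx b *m b) : mxstar A n).
Proof.
pose v l r u (i : 'I_n) : A := \sum_p ev t (entry (b l i) r p) *: d u p.
have -> : map_mx pairing (adjmx b *m b) =
  \sum_l \sum_r \sum_u (\matrix_(i, j) (star (v l r u i) * v l r u j) : mxstar A n).
  apply: entryP => i j; rewrite [LHS]mxE mxE.
  rewrite (@linear_sum _ _ _ _ pairing) entry_sum; apply: eq_bigr => l _.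
  rewrite entry_sum !mxE /pairing.
  under [RHS]eq_bigr => r _.
    rewrite entry_sum; under eq_bigr => u _ do rewrite [entry _ _ _]mxE star_sum mulr_suml.
    rewrite exchange_big /=; under eq_bigr => p _.
      under eq_bigr => u _ do rewrite mulr_sumr.
      rewrite exchange_big /=; under eq_bigr => q _.
        under eq_bigr => u _ do rewrite starZ starAl starAr scalerA.
        rewrite -scaler_sumr -/(gram p q); over.
      over.
    over.
  rewrite [RHS]exchange_big /=; apply: eq_bigr => p _.
  rewrite [RHS]exchange_big /=; apply: eq_bigr => q _.
  rewrite -scaler_suml; congr (_ *: _).
  rewrite entryM ev_sum; apply: eq_bigr => r _.
  by rewrite evM entry_star ev_star.
by apply: sos_sum => l; apply: sos_sum => r; apply: sos_sum => u; exact: sos_gram.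
Qed.

End MatrixPairing.

(** * Unital lifts on one summand *)

Section LiftCk.
Variables (R : realType) (A : cstarAlgType R) (J : closedIdeal A) (k : nat).
Local Notation K := k.+1.
Variable phi : {linear Ck R K -> staralg_mou (cquot J)}.
Hypothesis phi_ucp : ucp phi.

Lemma Ck_unit_subproof i j : (munit i j 1 : mxalg (C01 R) K) \in @Ck_span R K.
Proof. by apply: mem_lspan; exists i, j; left. Qed.

Lemma Ck_coord_subproof i j : (munit i j (C01_coord R) : mxalg (C01 R) K) \in @Ck_span R K.
Proof. by apply: mem_lspan; exists i, j; right. Qed.

Definition Ck_unit i j : Ck R K := Sub (munit i j 1 : mxalg (C01 R) K) (Ck_unit_subproof i j).
Definition Ck_coord i j : Ck R K :=
  Sub (munit i j (C01_coord R) : mxalg (C01 R) K) (Ck_coord_subproof i j).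

(** The square root has first row e_0j (x) s and zeros below. *)
Lemma mou_pos_square (s : C01 R) (e : 'I_K -> 'I_K -> Ck R K) :
  star s = s -> (forall i j, val (e i j) = munit i j ((s : (C01 R : starAlgType R)) * s)) ->
  mou_pos (\matrix_(i, j) e i j : 'M[Ck R K]_K).
Proof.
move=> ss eE; exists (\matrix_(i, j) (munit ord0 j s *+ (i == ord0))).
apply/matrixP => i j; rewrite !mxE eE big_ord_recl big1 => [|l _].
  by rewrite !mxE eqxx !mulr1n addr0 star_munit ss munitM.
by rewrite !mxE !mulr0n mulr0.
Qed.

(** Complete positivity at level K gives a factorization over the quotient; the entries of the
    factor are lifted arbitrarily and the Gram form survives. *)
Lemma mou_pos_gram (e : 'I_K -> 'I_K -> Ck R K) :
  mou_pos (\matrix_(i, j) e i j : 'M[Ck R K]_K) ->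
  exists d : 'I_K -> 'I_K -> A, forall i j, cq J (gram d i j) = phi (e i j).
Proof.
move=> /(phi_ucp.2) [d de]; exists (fun u i => srepr (d u i : cquot J)) => i j.
have := congr1 (fun M : 'M_K => M i j) de; rewrite !mxE => ->.
rewrite /gram cq_sum; apply: eq_bigr => u _.
by rewrite cqM cq_star !cq_surj !mxE.
Qed.

Lemma sqrtC01 (g : R -> R) : continuous g ->
  (forall t : unitI R, 0 <= g (sval t)) ->
  exists2 s : C01 R, star s = s &
    forall t, ev t ((s : (C01 R : starAlgType R)) * s) = cR (g (sval t)).
Proof.
move=> cg g0; have cs : continuous (Num.sqrt \o g).
  by move=> x; apply: continuous_comp; [exact: cg|exact: sqrt_continuous].
exists (real_C01 cs); first by apply: ev_inj => t; rewrite ev_star ev_real cR_conj.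
by move=> t; rewrite evM ev_real -cRM /= -expr2 sqr_sqrtr.
Qed.

Lemma coord_ge0 : mou_pos (\matrix_(i, j) Ck_coord i j : 'M[Ck R K]_K).
Proof.
have [|t|s ss sE] := @sqrtC01 id; first by move=> x; exact: cvg_id.
  by case/andP: (unitI01 t).
apply: (mou_pos_square ss) => i j; congr munit; apply: ev_inj => t.
by rewrite sE.
Qed.

Lemma sub_coord_ge0 : mou_pos (\matrix_(i, j) (Ck_unit i j - Ck_coord i j) : 'M[Ck R K]_K).
Proof.
have [|t|s ss sE] := @sqrtC01 (fun x => 1 - x).
- by move=> x; apply: cvgB; [exact: cvg_cst|exact: cvg_id].
- by rewrite subr_ge0; case/andP: (unitI01 t).
apply: (mou_pos_square ss) => i j; rewrite raddfB /=.
transitivity (munit i j ((1 : (C01 R : starAlgType R)) - C01_coord R)).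
  by rewrite munitB.
congr munit; apply: ev_inj => t.
by rewrite sE cRB cR1.
Qed.

Lemma Ck_lift : exists psi : {linear Ck R K -> staralg_mou A},
  [/\ psi (mou_unit (Ck R K)) = 1, (forall x, cq J (psi x) = phi x) &
      forall n (x : 'M[Ck R K]_n), mou_pos x -> sos (map_mx psi x : mxstar A n)].
Proof.
have [dP dPE] := mou_pos_gram coord_ge0.
have [dQ dQE] := mou_pos_gram sub_coord_ge0.
pose s : A := \sum_i (gram dP i i + gram dQ i i).
have ps : cpos s.
  have cp I (r : seq I) (F : I -> A) : (forall i, cpos (F i)) -> cpos (\sum_(i <- r) F i).
    move=> h; elim: r => [|i r ih]; last by rewrite big_cons; exact: cposD.
    by rewrite big_nil; have := cpos_rcst A (lexx 0); rewrite /rcst cR0 scale0r.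
  by apply: (cp) => i; apply: cposD; apply: (cp) => u; exact: cpos_mulstar.
have qs : cq J s = 1.
  have -> : cq J s = phi (mou_unit (Ck R K)).
    rewrite cq_sum; under eq_bigr => i _ do rewrite cqD dPE dQE -linearD addrC subrK.
    rewrite -linear_sum; congr (phi _); apply: val_inj; rewrite raddf_sum /=.
    apply: entryP => p q; rewrite entry_sum entry1 (bigD1 p)//= entry_munit eqxx.
    rewrite big1 => [|i ip]; first by rewrite addr0 eq_sym.
    by rewrite entry_munit eq_sym (negPf ip).
  exact: phi_ucp.1.
have [v [v1 v2]] := cpos_inv ps ltr01; rewrite rcst1 in v1 v2.
have vs : star v = v.
  by apply: star_inv v1 v2; rewrite starD star1 ps.1.
pose c := v + v.
have cs : star c = c by rewrite starD vs.
(* Hence c s c = 2 c - c^2 = 1 - (1 - c)^2. *)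
have sc : s * c = 1 + 1 - c.
  have sv : s * v = 1 - v by rewrite -v2 mulrDl mul1r addrC addKr.
  by rewrite /c mulrDr sv; ncring.
have qc : cq J c = 1.
  by move: (congr1 (cq J) v1); rewrite cqM cqD qs cq1 mulrDr mulr1 /c cqD.
pose eP u i := dP u i * c; pose eQ u i := dQ u i * c.
(* A single row, with Gram matrix (1 - c)^2 e_00: it supplies the missing trace and vanishes modulo
   J. *)
pose eU (u : 'I_1) (i : 'I_K) : A := (1 - c) *+ (i == ord0).
have gramc d i j : gram (fun u i => d u i * c) i j = c * gram d i j * c :> A.
  rewrite /gram mulr_sumr mulr_suml; apply: eq_bigr => u _.
  by rewrite starM cs !mulrA.
(* Elements of C_k are affine in t, so their values at 1 and 0 are the coefficients of t and 1 - t,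
   to be paired with P and Q. *)
pose psi0 (x : mxstar (C01 R) K) :=
  pairing (end1 R) eP x + (pairing (end0 R) eQ x + pairing (end0 R) eU x).
have psi0_lin : linear psi0.
  by move=> a x y; rewrite /psi0 !linearP !scalerDr; ncring.
have psi_lin : linear (fun x : Ck R K => psi0 (val x) : staralg_mou A).
  by move=> a x y; rewrite linearP psi0_lin.
pose psi_mixin := GRing.isLinear.Build _ _ _ _ _ psi_lin.
pose psi : {linear Ck R K -> staralg_mou A} :=
  HB.pack (fun x : Ck R K => psi0 (val x) : staralg_mou A) psi_mixin.
have psiE x : psi x = psi0 (val x) by [].
exists psi; split.
- rewrite psiE /= /psi0 !pairing1.
  under eq_bigr => p _ do rewrite gramc.
  under [X in _ + (X + _)]eq_bigr => p _ do rewrite gramc.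
  rewrite addrA -!mulr_suml -!mulr_sumr -mulrDl -mulrDr -big_split /= -/s.
  rewrite big_ord_recl big1 => [|p _]; last by rewrite /gram big_ord1 /eU mulr0n mulr0.
  rewrite /gram big_ord1 /eU eqxx mulr1n addr0 starB star1 cs.
  by rewrite -mulrA sc; ncring.
- have psi_gen i j f : cq J (psi0 (munit i j f)) =
      ev (end1 R) f *: phi (Ck_coord i j) + ev (end0 R) f *: phi (Ck_unit i j - Ck_coord i j).
    rewrite /psi0 !pairing_munit !cqD !cqZ !gramc !cqM qc !mul1r !mulr1 dPE dQE.
    rewrite [X in _ + (_ + X)](_ : _ = 0) ?addr0// /gram big_ord1 cqM /eU.
    have -> : cq J ((1 - c) *+ (j == ord0)) = 0.
      case: (_ == _); rewrite ?mulr1n ?mulr0n; first by rewrite cqB cq1 qc subrr.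
      by rewrite -(subrr (0 : A)) cqB subrr.
    by rewrite mulr0 scaler0.
  have e10 : ev (end0 R) (C01_coord R) = 0 by [].
  have e11 : ev (end1 R) (C01_coord R) = 1 by [].
  move=> x; rewrite psiE; have /lspanP[l lg xE] := valP x.
  elim: l x lg xE => [|[a g] l ih] x lg xE.
    have -> : x = 0 by apply: val_inj; rewrite xE big_nil.
    have psi00 : psi0 0 = 0 by rewrite /psi0 !linear0 !addr0.
    by rewrite linear0 [psi0 _]psi00 -(subrr (0 : A)) cqB subrr.
  have [y yg phiy] : exists2 y : Ck R K, val y = g & cq J (psi0 g) = phi y.
    have [i [j [|] /= ->]] := lg _ (mem_head _ _).
      exists (Ck_unit i j) => //; rewrite psi_gen !ev1 !scale1r -linearD addrC.
      by rewrite subrK.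
    exists (Ck_coord i j) => //.
    by rewrite psi_gen e10 e11 scale1r scale0r addr0.
  (* The tail of the combination is again an element of C_k, to which the induction hypothesis
     applies. *)
  pose z := x - a *: y.
  have zE : val z = \sum_(p <- l) p.1 *: p.2.
    by rewrite raddfB linearZ /= yg xE big_cons /= scalerN addrAC subrr add0r.
  have -> : x = a *: y + z by rewrite addrC subrK.
  have -> : val (a *: y + z) = a *: g + val z by rewrite linearP /= yg.
  rewrite psi0_lin cqD cqZ [RHS]linearP phiy (ih z) // => p pl.
  by apply: lg; rewrite inE pl orbT.
(* The factor b need not have entries in C_k; this is why [psi0] is defined on all of
   M_k(C([0,1])). *)
- move=> n x [b xb].
  have -> : map_mx psi x = map_mx (pairing (end1 R) eP) (adjmx b *m b) +
    (map_mx (pairing (end0 R) eQ) (adjmx b *m b) +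
     map_mx (pairing (end0 R) eU) (adjmx b *m b)) :> mxstar A n.
    by rewrite -xb; apply: entryP => i j; rewrite !entryD /entry !mxE psiE.
  by apply: sosD; [|apply: sosD]; exact: pairing_sos.
Qed.

End LiftCk.

(** * Gluing on the coproduct *)

Section PositiveFunctionalState.
Variables (R : realType) (B : starAlgType R) (f : B -> R).
Hypothesis pf : posfun f.

(* The complex-linear functional with real part f. *)
Definition cfun (x : B) : cplx R := cR (f x) - 'i * cR (f ('i *: x)).

Lemma cfun_linear (a : cplx R) (x y : B) : cfun (a *: x + y) = a * cfun x + cfun y.
Proof.
have [fD fZ fs fp] := pf.
have cD u v : cfun (u + v) = cfun u + cfun v.
  by rewrite /cfun scalerDr !fD !cRD; ring.
have cr r u : cfun (cR r *: u) = cR r * cfun u.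
  by rewrite /cfun scalerA [_ * cR r]mulrC -scalerA !fZ !cRM; ring.
have ci u : cfun ('i *: u) = 'i * cfun u.
  rewrite /cfun scalerA mulii scaleN1r posfunN// cRN mulrBr mulrA mulii; ring.
rewrite cD; congr (_ + _); rewrite [a]cplxE scalerDl cD cr mulrDl -scalerA ci cr.
by rewrite mulrA.
Qed.

Lemma cfun_sos x : sos x -> cfun x = cR (f x).
Proof. by move=> /(posfun_sos pf)[_ fx]; rewrite /cfun fx cR0 mulr0 subr0. Qed.

Lemma cfun1 : cfun 1 = cR (f 1).
Proof. by apply: cfun_sos; exists [:: 1]; rewrite big_seq1 star1 mulr1. Qed.

Lemma cfun_ge0 x : 0 <= cfun x -> 0 <= f x /\ f ('i *: x) = 0.
Proof.
have -> : cfun x = (f x +i* (- f ('i *: x)))%C.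
  by rewrite [RHS]cplxE /= cRN mulrN.
by rewrite lecE /= oppr_eq0 => /andP[/eqP -> ->].
Qed.

(** When f(1) = 0, positivity on the square of x + r reads f(x^* x) + 2 r f(x) >= 0 for every real
    r. *)
Lemma posfun_eq0 x : f 1 = 0 -> f x = 0.
Proof.
move=> f1; have [fD fZ fs fp] := pf.
have h (r : R) : 0 <= f (star x * x) + 2 * (r * f x).
  have := fp (x + rcst B r).
  rewrite starD star_rcst mulrDl !mulrDr !rcst_mull !rcst_mulr rcstZ !fD !fZ fs.
  by rewrite /rcst ?fZ f1; lra.
have [//|n0] := eqVneq (f x) 0.
(* This r makes the left side equal to -1. *)
have := h (- (f (star x * x) + 1) / (2 * f x)).
rewrite (_ : 2 * _ = - (f (star x * x) + 1)); first by lra.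
by field.
Qed.

End PositiveFunctionalState.

(** * Maps out of the coproduct *)

Section CoproductMap.
Variables (R : realType) (L : choiceType) (S : L -> mouSpace R) (T : mouSpace R).
Variable psi : forall l, {linear S l -> T}.
Hypothesis psi_unit : forall l, psi l (mou_unit (S l)) = mou_unit T.

Definition dsum_map (d : dsum S) : T := \sum_(l \in [set: L]) psi l (val d l).

Lemma dsum_map_linear : linear dsum_map.
Proof.
move=> a d e; rewrite /dsum_map.
(* All three sums are compared over the union of the two supports. *)
have fU : finite_set ([set l | val d l != 0] `|` [set l | val e l != 0]).
  by rewrite finite_setU; split; [exact: (asboolW (valP d))|exact: (asboolW (valP e))].
have E (x : dsum S) :
    (forall l, val x l != 0 -> ([set l | val d l != 0] `|` [set l | val e l != 0]) l) ->
    \sum_(l \in [set: L]) psi l (val x l) =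
    \sum_(l <- fset_set ([set l | val d l != 0] `|` [set l | val e l != 0])) psi l (val x l).
  move=> h; rewrite -fsbig_finite//; apply/esym/fsbig_widen => // l [_ /= nl].
  have [->|/h//] := eqVneq (val x l) 0; exact: linear0.
have vE l : (val (a *: d + e : dsum S) : dprod S) l = a *: val d l + val e l by [].
rewrite !E; first 1 last.
- by move=> l; right.
- by move=> l; left.
- move=> l; rewrite vE; have [dl|dl _] := eqVneq (val d l) 0; last by left.
  by rewrite dl scaler0 add0r => el; right.
rewrite scaler_sumr -big_split; apply: eq_bigr => l _ /=.
exact: (linearP (psi l)).
Qed.

HB.instance Definition _ := GRing.isLinear.Build _ _ _ _ dsum_map dsum_map_linear.

Lemma coprod_in_linear l : linear (@coprod_in R L S l).
Proof.
move=> a x y; rewrite /coprod_in -[RHS](@sproj_linear R _ _ a); congr sproj.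
apply: val_inj; apply: dprodP => m /=.
rewrite -[RHS]/(a *: dinj_fun x m + dinj_fun y m) /dinj_fun.
by case: dfwithP => [|i li]; rewrite ?dfwith_in// !dfwith_out// scaler0 addr0.
Qed.

HB.instance Definition _ l :=
  GRing.isLinear.Build _ _ _ _ (@coprod_in R L S l) (@coprod_in_linear l).

Lemma coprod_in_pos l n (x : 'M[S l]_n) : mou_pos x ->
  mou_pos (map_mx (@coprod_in R L S l) x : 'M[coprod S]_n).
Proof.
move=> xp; exists [fset l]%fset, (dfwith (fun m => 0 : 'M[S m]_n) x).
rewrite !big_seq_fset1 dfwith_in; split=> // w ws _.
rewrite big_seq_fset1 dfwith_in; have [|_ wp _] := ws l; first by rewrite inE.
exact: wp.
Qed.

Lemma dsum_map_inj l (x : S l) : dsum_map (@dinj R L S l x) = psi l x.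
Proof.
rewrite /dsum_map -(fsbig_widen [set l]) ?fsbig_set1//=.
  by rewrite /dinj_fun dfwith_in.
by move=> m [_ /= /eqP ml]; rewrite /dinj_fun dfwith_out ?linear0// eq_sym.
Qed.

(** The maps agree on units, hence kill every n_l - n_m; this makes [coprod_map] independent of the
    representative. *)
Lemma dsum_map_rel d : d \in @unit_rel R L S -> dsum_map d = 0.
Proof.
move=> /lspanP[s sX ->]; rewrite linear_sum big_seq big1// => p /sX[l [m ->]].
by rewrite linearZ linearB /= !dsum_map_inj !psi_unit subrr scaler0.
Qed.

Definition coprod_map (x : coprod S) : T := dsum_map (srepr (x : squot (@unit_rel R L S))).

Lemma coprod_map_proj d : coprod_map (sproj (@unit_rel R L S) d) = dsum_map d.
Proof.
apply/eqP; rewrite -subr_eq0 -linearB; apply/eqP; apply: dsum_map_rel.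
by apply/sproj_eq; rewrite sreprK.
Qed.

Lemma coprod_map_linear : linear coprod_map.
Proof.
move=> a x y; rewrite -(sreprK x) -(sreprK y) -[_ + _](@sproj_linear R _ _ a) !coprod_map_proj.
exact: linearP.
Qed.

Lemma coprod_map_in l (x : S l) : coprod_map (coprod_in x) = psi l x.
Proof. by rewrite coprod_map_proj dsum_map_inj. Qed.

Lemma dsum_sum (d : dsum S) :
  d = \sum_(l <- fset_set [set l | val d l != 0]) @dinj R L S l (val d l).
Proof.
have fd : finite_set [set l | val d l != 0] := asboolW (valP d).
apply: val_inj; rewrite raddf_sum; apply: dprodP => m.
have E (I : Type) (s : seq I) (F : I -> dprod S) : (\sum_(i <- s) F i) m = \sum_(i <- s) F i m.
  by elim: s => [|i s ih]; rewrite ?big_nil// !big_cons -ih.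
rewrite E /=.
have [dm|dm] := eqVneq (val d m) 0.
  rewrite dm big_seq big1// => l; rewrite in_fset_set// inE /= => dl.
  by rewrite /dinj_fun dfwith_out//; apply: contraNneq dl => ->; rewrite dm.
rewrite (big_fsetD1 m) /=; last by rewrite in_fset_set// inE.
rewrite {1}/dinj_fun dfwith_in big_seq big1 ?addr0// => l; rewrite !inE => /andP[lm _].
by rewrite /dinj_fun dfwith_out.
Qed.

Lemma coprod_sum (x : coprod S) : exists (F : seq L) (y : forall l, S l),
  x = \sum_(l <- F) coprod_in (y l).
Proof.
pose d := srepr (x : squot (@unit_rel R L S)).
exists (fset_set [set l | val d l != 0]), (val d).
by rewrite -[LHS]sreprK -/d {1}[d]dsum_sum linear_sum.
Qed.

End CoproductMap.

Theorem theorem3p7 (R : realType) (I : choiceType) (I_ : nat -> choiceType)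
    (I_nonempty : [set: I] !=set0)
    (I_card : forall k : nat, ([set: I_ k] #= [set: I])%card)
    (A : cstarAlgType R) (J : closedIdeal A)
    (phi : {linear C_I R I_ -> staralg_mou (cquot J)}) :
  ucp phi ->
  exists psi : {linear C_I R I_ -> staralg_mou A},
    ucp psi /\ forall x, cproj J (psi x) = phi x.
Proof.
move=> [phi1 phi_pos]; pose S (l : {k : nat & I_ k}) := Ck R (tag l).+1.
(* A summand is needed to identify the unit of the coproduct, which defaults to 0 for an empty
   family. *)
have [l0 _] : exists l : {k : nat & I_ k}, True.
  apply: contrapT => nl; have e : [set: I_ 0%N] = set0.
    by apply/seteqP; split=> // i _; apply: nl; exists (existT _ 0%N i).
  have := I_card 0%N; rewrite e card_eq_sym card_eq0 => /eqP I0.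
  by case: I_nonempty => i; rewrite I0.
pose phi_l l : {linear S l -> staralg_mou (cquot J)} := phi \o @coprod_in R _ S l.
have phi_ucp l : ucp (phi_l l).
  split; first by rewrite /= -coprod_unitE.
  by move=> n x /coprod_in_pos /phi_pos; rewrite -map_mx_comp.
pose psi l := sval (cid (Ck_lift (phi_ucp l))).
have psiP l := svalP (cid (Ck_lift (phi_ucp l))).
have psi1 l : psi l (mou_unit (S l)) = 1 by case: (psiP l).
have psi_phi l x : cq J (psi l x) = phi_l l x by case: (psiP l).
have psi_sos l n (x : 'M[S l]_n) : mou_pos x -> sos (map_mx (psi l) x : mxstar A n).
  by case: (psiP l) => _ _; exact.
pose Psi : {linear C_I R I_ -> staralg_mou A} := HB.pack (coprod_map psi)
  (GRing.isLinear.Build _ _ _ _ (coprod_map psi) (coprod_map_linear psi1)).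
have PsiE l (x : S l) : Psi (coprod_in x) = psi l x by exact: coprod_map_in psi1 _ _.
exists Psi; split; last first.
  move=> x; have [F [y ->]] := coprod_sum x.
  rewrite [Psi _]linear_sum [RHS]linear_sum -[LHS]/(cq J _) cq_sum.
  by apply: eq_bigr => l _; rewrite PsiE psi_phi.
have unitE : mou_unit (C_I R I_) = coprod_in (mou_unit (S l0)) := coprod_unitE S l0.
split; first by rewrite unitE [LHS]PsiE psi1.
move=> n X [F [x [-> xp]]].
pose Y l : mxstar A n := map_mx (psi l) (x l).
have -> : map_mx Psi (\sum_(l <- F) map_mx (@coprod_in R _ S l) (x l)) = \sum_(l <- F) Y l.
  apply: entryP => i j; rewrite entry_sum [LHS]mxE summxE linear_sum.
  by apply: eq_bigr => l _; rewrite mxE [LHS]PsiE /entry mxE.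
suff [b ->] : exists b : mxstar A n, \sum_(l <- F) Y l = star b * b by exists b.
apply: posfun_pos => f pf.
(* A functional with f(1) = 0 vanishes identically; any other can be normalized to a state. *)
have [f0|f_neq0] := eqVneq (f 1) 0; first by split; rewrite (posfun_eq0 pf _ f0).
have f1 : 0 < cR (f 1) by rewrite cR_gt0 lt_def f_neq0 posfun1.
(* The image of a (x) 1 is independent of l, which makes the pulled-back states compatible. *)
have psi_unit l (a : 'M[cplx R]_n) :
    map_mx (psi l) (unit_mx (S l) a) = map_mx (fun z => z *: (1 : A)) a.
  by apply/matrixP => i j; rewrite !mxE linearZ /= psi1.
pose w l (z : 'M[S l]_n) := cfun f (map_mx (psi l) z : mxstar A n) / cR (f 1).
have wx : 0 <= \sum_(l <- F) w l (x l).
  apply: xp => [l _|l m _ _ a]; last by rewrite /w !psi_unit.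
  split=> [a y z|y yp|].
  - rewrite /w mulrA -mulrDl -cfun_linear//; congr (cfun f _ / _).
    by apply: entryP => i j; rewrite entryD entryZ /entry !mxE linearP.
  - rewrite /w divr_ge0 ?(ltW f1)// cfun_sos//; last exact: psi_sos.
    by rewrite cR_ge0; case: (posfun_sos pf (psi_sos _ _ _ yp)).
  - rewrite /w psi_unit (_ : map_mx _ _ = (1 : mxstar A n)).
      by rewrite cfun1// divff// gt_eqF.
    apply: entryP => i j; rewrite entry1 /entry !mxE.
    by case: (_ == _); rewrite ?scale1r ?scale0r.
(* Nonnegativity in the complex order includes that the imaginary part is 0, so one inequality gives
   both conditions on f. *)
apply: cfun_ge0.
have -> : cfun f (\sum_(l <- F) Y l) = (\sum_(l <- F) w l (x l)) * cR (f 1).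
  rewrite mulr_suml.
  have cf0 : cfun f 0 = 0.
    by rewrite (cfun_sos pf (@sos0 R _)) -(subrr 0) posfunB// subrr cR0.
  elim: (enum_fset F) => [|l s ih]; first by rewrite !big_nil.
  rewrite !big_cons -[Y l]scale1r cfun_linear// mul1r ih; congr (_ + _).
  by rewrite /w divfK// gt_eqF.
by rewrite mulr_ge0// ltW.
Qed.
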